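(* Let $G\cong\mathbb{Z}_k\rtimes_n\mathbb{Z}_{ql}$ and let $V$ be any finite-dimensional (left) module over $\mathcal{D}(G)$. Then $\nu_m(V)\in\mathbb{Z}$ for all $m\in\mathbb{N}$. Moreover, if $q\nmid l$ and either $q\neq 2$ or $8\nmid k$, then $\nu_m(V)\in\mathbb{N}\cup\{0\}$ for all $m\in\mathbb{N}$.
   Context: $\mathbb{N}=\{1,2,3,\dots\}$. Let $k,q,l,n\in\mathbb{N}$ with $q$ a prime dividing $|\mathrm{Aut}(\mathbb{Z}_k)|$, $n^q\equiv 1\bmod k$ and $n\not\equiv 1\bmod k$. Then $\mathbb{Z}_k\rtimes_n\mathbb{Z}_{ql}$ denotes the (non-abelian, order $kql$) group $\langle a,b\mid a^k=b^{ql}=1,\ bab^{-1}=a^n\rangle$. For a finite group $G$, the Drinfel'd double $\mathcal{D}(G)$ is the complex Hopf algebra with basis $\{p_g\bowtie x : g,x\in G\}$, multiplication $(p_g\bowtie x)(p_h\bowtie y)=\delta_{g,xhx^{-1}}\,p_g\bowtie xy$, unit $\sum_g p_g\bowtie 1$, comultiplication $\Delta(p_g\bowtie x)=\sum_{uv=g}(p_u\bowtie x)\otimes(p_v\bowtie x)$ and counit $\epsilon(p_g\bowtie x)=\delta_{g,1}$. Its integral with counit value 1 is $\Lambda=\frac{1}{|G|}\sum_{x\in G}p_1\bowtie x$. Put $\Lambda^{[m]}=\sum\Lambda_1\Lambda_2\cdots\Lambda_m$ (the product of the $m$ tensor factors of the iterated comultiplication of $\Lambda$). For a finite-dimensional $\mathcal{D}(G)$-module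 $V$ with character $\chi$, the $m$-th indicator is $\nu_m(V)=\chi(\Lambda^{[m]})$. *)

(* Defs.v *)
From HB Require Import structures.
From mathcomp Require Import all_boot all_order all_fingroup all_algebra.
From mathcomp Require Import all_solvable.
From mathcomp Require Import complex.
From mathcomp Require Import reals.

Set Implicit Arguments.
Unset Strict Implicit.
Unset Printing Implicit Defensive.

Import GRing.Theory.
Local Open Scope ring_scope.

(* The underlying vector space of the Drinfel'd double of the finite group G: *)
(* the element \sum_(g, x) c (g, x) (p_g >< x) is the finite function c.      *)
Definition drinfeld_double (F : fieldType) (G : finGroupType) : Type :=
  {ffun G * G -> F}.

HB.instance Definition _ (F : fieldType) (G : finGroupType) :=
  GRing.Lmodule.copy (drinfeld_double F G) {ffun G * G -> F^o}.

Section DrinfeldDouble.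

Variables (F : fieldType) (G : finGroupType).
Notation D := (drinfeld_double F G).

(* dd_basis (g, x) is p_g >< x *)
Definition dd_basis (b : G * G) : D := [ffun c => (c == b)%:R].

Definition dd_basis_mul (b c : G * G) : D :=
  dd_basis (b.1, (b.2 * c.2)%g) *+ (b.1 == b.2 * c.1 * b.2^-1)%g.

Definition dd_mul (f h : D) : D :=
  \sum_(b : G * G) \sum_(c : G * G) (f b * h c) *: dd_basis_mul b c.

Definition dd_one : D := \sum_(g : G) dd_basis (g, 1%g).

Lemma dd_decomp (f : D) : f = \sum_b f b *: dd_basis b.
Proof.
apply/ffunP => c; rewrite sum_ffunE (bigD1 c) //= big1 => [|b bc].
  by rewrite !ffunE eqxx addr0; exact: (esym (mulr1 _)).
by rewrite !ffunE eq_sym (negPf bc); exact: mulr0.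
Qed.

Lemma dd_mulDl : left_distributive dd_mul +%R.
Proof.
move=> f g h; rewrite /dd_mul -big_split; apply: eq_bigr => b _ /=.
rewrite -big_split; apply: eq_bigr => c _ /=.
by rewrite !ffunE mulrDl scalerDl.
Qed.

Lemma dd_mulDr : right_distributive dd_mul +%R.
Proof.
move=> f g h; rewrite /dd_mul -big_split; apply: eq_bigr => b _ /=.
rewrite -big_split; apply: eq_bigr => c _ /=.
by rewrite !ffunE mulrDr scalerDl.
Qed.

Lemma dd_mulZl (a : F) (f h : D) : a *: dd_mul f h = dd_mul (a *: f) h.
Proof.
rewrite /dd_mul scaler_sumr; apply: eq_bigr => b _.
rewrite scaler_sumr; apply: eq_bigr => c _.
by rewrite scalerA ffunE mulrA.
Qed.

Lemma dd_mulZr (a : F) (f h : D) : a *: dd_mul f h = dd_mul f (a *: h).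
Proof.
rewrite /dd_mul scaler_sumr; apply: eq_bigr => b _.
rewrite scaler_sumr; apply: eq_bigr => c _.
by rewrite scalerA ffunE mulrCA.
Qed.

Lemma dd_mul0l h : dd_mul 0 h = 0.
Proof. by rewrite -[0 in LHS](scale0r (0 : D)) -dd_mulZl scale0r. Qed.

Lemma dd_mul0r h : dd_mul h 0 = 0.
Proof. by rewrite -[0 in LHS](scale0r (0 : D)) -dd_mulZr scale0r. Qed.

Lemma dd_mul_suml (I : finType) (f : I -> D) h :
  dd_mul (\sum_i f i) h = \sum_i dd_mul (f i) h.
Proof.
by apply: (big_morph (dd_mul^~ h)) => [x y|]; [exact: dd_mulDl|exact: dd_mul0l].
Qed.

Lemma dd_mul_sumr (I : finType) (f : I -> D) h :
  dd_mul h (\sum_i f i) = \sum_i dd_mul h (f i).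
Proof.
by apply: (big_morph (dd_mul h)) => [x y|]; [exact: dd_mulDr|exact: dd_mul0r].
Qed.

Lemma dd_basis_mulE b c : dd_mul (dd_basis b) (dd_basis c) = dd_basis_mul b c.
Proof.
rewrite /dd_mul (bigD1 b) //= (bigD1 c) //= !ffunE !eqxx mulr1 scale1r.
rewrite big1 ?addr0 => [|d /negPf dc]; last by rewrite !ffunE dc mulr0 scale0r.
rewrite big1 ?addr0 // => d /negPf db.
by rewrite big1 // => e _; rewrite ffunE db mul0r scale0r.
Qed.

Lemma dd_mulA : associative dd_mul.
Proof.
have assoc_basis b c d :
    dd_mul (dd_basis b) (dd_mul (dd_basis c) (dd_basis d)) =
    dd_mul (dd_mul (dd_basis b) (dd_basis c)) (dd_basis d).
  case: b c d => [g1 x1] [g2 x2] [g3 x3].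
  rewrite !dd_basis_mulE /dd_basis_mul /=.
  have [->|n2] := eqVneq g2; last first.
    rewrite mulr0n dd_mul0r.
    have [e1|_] := eqVneq g1; last by rewrite mulr0n dd_mul0l.
    rewrite mulr1n dd_basis_mulE /dd_basis_mul /= e1 invMg.
    rewrite -!mulgA (inj_eq (mulgI _)) !mulgA (inj_eq (mulIg _)).
    by rewrite (negPf n2) mulr0n.
  rewrite mulr1n dd_basis_mulE /dd_basis_mul /=.
  have [e1|n1] := eqVneq g1; last first.
    by rewrite !mulr0n dd_mul0l.
  by rewrite !mulr1n dd_basis_mulE /dd_basis_mul /= e1 invMg !mulgA eqxx.
move: assoc_basis dd_mulZl dd_mulZr dd_mul_suml dd_mul_sumr.
move: dd_mul => mu assoc_basis Zl Zr suml sumr f g h.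
rewrite (dd_decomp f) (dd_decomp g) (dd_decomp h).
rewrite !suml; apply: eq_bigr => b _.
rewrite sumr (sumr _ _ (f b *: _)) suml; apply: eq_bigr => c _.
rewrite !sumr; apply: eq_bigr => d _.
by rewrite -!(Zl, Zr) assoc_basis !scalerA mulrC mulrA.
Qed.

Lemma dd_mul1l : left_id dd_one dd_mul.
Proof.
move=> f; rewrite /dd_one dd_mul_suml {2}(dd_decomp f).
under eq_bigr do rewrite {1}(dd_decomp f) dd_mul_sumr.
rewrite exchange_big; apply: eq_bigr => -[h y] _ /=.
under eq_bigr do rewrite -dd_mulZr dd_basis_mulE /dd_basis_mul /=
  invg1 mulg1 !mul1g.
rewrite (bigD1 h) //= eqxx mulr1n big1 ?addr0 // => g /negPf ->.
by rewrite mulr0n scaler0.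
Qed.

Lemma dd_mul1r : right_id dd_one dd_mul.
Proof.
move=> f; rewrite /dd_one dd_mul_sumr {2}(dd_decomp f).
under eq_bigr do rewrite {1}(dd_decomp f) dd_mul_suml.
rewrite exchange_big; apply: eq_bigr => -[h y] _ /=.
under eq_bigr do rewrite -dd_mulZl dd_basis_mulE /dd_basis_mul /= mulg1.
rewrite (bigD1 (y^-1 * h * y)%g) //= !mulgA mulgV mul1g mulgK eqxx mulr1n.
rewrite big1 ?addr0 // => g gn; case: eqP => [e|_]; last first.
  by rewrite mulr0n scaler0.
by case/eqP: gn; rewrite e !mulgA mulVg mul1g mulgKV.
Qed.

Lemma dd_one_neq0 : dd_one != 0.
Proof.
apply/eqP => /ffunP /(_ (1%g, 1%g)); rewrite /dd_one sum_ffunE (bigD1 1%g) //=.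
rewrite !ffunE eqxx big1 ?addr0 => [|g /negPf gn]; first exact/eqP/oner_neq0.
by rewrite ffunE xpair_eqE eq_sym gn.
Qed.

HB.instance Definition _ := GRing.Zmodule_isNzRing.Build D
  dd_mulA dd_mul1l dd_mul1r dd_mulDl dd_mulDr dd_one_neq0.

HB.instance Definition _ := GRing.Lmodule_isLalgebra.Build F D dd_mulZl.

HB.instance Definition _ := GRing.Lalgebra_isAlgebra.Build F D dd_mulZr.

(* D (x) D is the vector space of finite functions on pairs of basis indices *)
Definition dd_comul (f : D) : {ffun (G * G) * (G * G) -> F} :=
  [ffun t => \sum_(b : G * G) f b *
    \sum_(uv : G * G | (uv.1 * uv.2)%g == b.1)
      (t == ((uv.1, b.2), (uv.2, b.2)))%:R].

Definition dd_counit (f : D) : F := \sum_(b : G * G) f b * (b.1 == 1%g)%:R.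

(* The m-th tensor power of D is the space of finite functions on m-tuples of *)
(* basis indices; the iterated comultiplication D -> D^{(x) m} is the counit  *)
(* for m = 0, and (id (x) Delta^(m)) o Delta for m + 1.                       *)
Fixpoint dd_itercomul (m : nat) : D -> {ffun m.-tuple (G * G) -> F} :=
  match m with
  | 0 => fun f => [ffun=> dd_counit f]
  | m'.+1 => fun f => [ffun t : m'.+1.-tuple (G * G) =>
      \sum_(c : G * G) dd_comul f (thead t, c) *
        dd_itercomul m' (dd_basis c) (behead_tuple t)]
  end.

(* multiplication D^{(x) m} -> D of the tensor factors, from left to right *)
Definition dd_tensor_mul (m : nat) (T : {ffun m.-tuple (G * G) -> F}) : D :=
  \sum_(t : m.-tuple (G * G)) T t *: \prod_(b <- t) dd_basis b.

(* x^{[m]} = \sum x_1 x_2 ... x_m *)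
Definition dd_sweedler_power (m : nat) (x : D) : D :=
  dd_tensor_mul (dd_itercomul m x).

Definition dd_integral : D :=
  #|G|%:R^-1 *: \sum_(x : G) dd_basis (1%g, x).

(* The next lemmas check the definitions: Delta^(1) is the identity, and, in  *)
(* good characteristic, dd_integral is the two-sided integral of counit 1.    *)
Lemma dd_comulE f (g h x y : G) :
  dd_comul f ((g, x), (h, y)) = f ((g * h)%g, x) * (x == y)%:R.
Proof.
rewrite ffunE (bigD1 ((g * h)%g, x)) //= (bigD1 (g, h)) //=.
rewrite !xpair_eqE !eqxx /= (eq_sym y) big1 ?addr0 => [|[u v]]; last first.
  case/andP=> _; rewrite !xpair_eqE /= (eq_sym u) (eq_sym v).
  by case: (g == u); case: (h == v); rewrite ?andbF.
rewrite big1 ?addr0 // => -[k z] n; rewrite big1 ?mulr0 // => -[u v] /= /eqP e.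
rewrite !xpair_eqE; case: eqP => //= eg; case: eqP => //= ez.
by case: eqP => //= eh; case/eqP: n; rewrite eg eh e ez.
Qed.

Lemma dd_itercomul1 f (t : 1.-tuple (G * G)) : dd_itercomul 1 f t = f (thead t).
Proof.
rewrite /= ffunE; case: (thead t) => g x.
rewrite (bigD1 (1%g, x)) //= dd_comulE mulg1 eqxx mulr1 ffunE /dd_counit.
rewrite (bigD1 (1%g, x)) //= !ffunE !eqxx mulr1 big1 ?addr0 => [|c /negPf cn].
  rewrite mulr1 big1 ?addr0 // => -[h y] n.
  rewrite dd_comulE ffunE; have [exy|_] := eqVneq x y; last first.
    by rewrite mulr0 mul0r.
  rewrite /dd_counit big1 ?mulr0 // => -[k z] _; rewrite ffunE xpair_eqE /=.
  case: (eqVneq k h) => [->|_]; last by rewrite mul0r.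
  case: (eqVneq h 1%g) => [e|_]; last by rewrite mulr0.
  by case/eqP: n; rewrite e exy.
by rewrite ffunE cn mul0r.
Qed.

Lemma dd_counit_basis b : dd_counit (dd_basis b) = (b.1 == 1%g)%:R.
Proof.
rewrite /dd_counit (bigD1 b) //= ffunE eqxx mul1r big1 ?addr0 // => c /negPf cb.
by rewrite ffunE cb mul0r.
Qed.

Lemma dd_integral_left b :
  dd_basis b * dd_integral = dd_counit (dd_basis b) *: dd_integral.
Proof.
rewrite dd_counit_basis /dd_integral -scalerAr scalerA mulrC -scalerA.
congr (_ *: _); rewrite mulr_sumr; case: b => g x /=.
under eq_bigr do rewrite [_ * _]dd_basis_mulE /dd_basis_mul /= mulg1 mulgV.
case: (eqVneq g) => [->|_]; last by rewrite big1 ?scale0r.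
by rewrite scale1r [RHS](reindex_inj (mulgI x)).
Qed.

Lemma dd_integral_right b :
  dd_integral * dd_basis b = dd_counit (dd_basis b) *: dd_integral.
Proof.
rewrite dd_counit_basis /dd_integral -scalerAl scalerA mulrC -scalerA.
congr (_ *: _); rewrite mulr_suml; case: b => g x /=.
have eq1 y : (1 == y * g * y^-1)%g = (g == 1%g).
  by rewrite eq_sym -eq_mulgV1 -{2}(mulg1 y) (inj_eq (mulgI _)).
under eq_bigr do rewrite [_ * _]dd_basis_mulE /dd_basis_mul /= eq1.
case: eqVneq => _; last by rewrite big1 ?scale0r.
by rewrite scale1r [RHS](reindex_inj (mulIg x)).
Qed.

Lemma dd_counit_integral : #|G|%:R != 0 :> F -> dd_counit dd_integral = 1.
Proof.
move=> G_neq0; rewrite /dd_counit /dd_integral.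
under eq_bigr do rewrite ffunE sum_ffunE -[_ *: _]/(_ * _) -mulrA mulr_suml.
rewrite -mulr_sumr exchange_big /=.
under eq_bigr => x _.
  rewrite (bigD1 (1%g, x)) //= ffunE !eqxx mulr1 big1 ?addr0 => [|c /negPf cx].
    over.
  by rewrite ffunE cx mul0r.
by rewrite sumr_const mulVf.
Qed.

End DrinfeldDouble.

(* A left module structure over the F-algebra A on the finite-dimensional     *)
(* F-space V, given by the action of the elements of A.                       *)
Definition is_left_module (F : fieldType) (A : algType F) (V : vectType F)
    (rho : {linear A -> 'End(V)}) : Prop :=
  rho 1 = \1%VF /\ forall x y : A, rho (x * y) = (rho x \o rho y)%VF.

Definition lfun_trace (F : fieldType) (V : vectType F) (f : 'End(V)) : F :=
  \tr (passmx.mxof (vbasis {:V}) (vbasis {:V}) f).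

Definition dd_indicator (F : fieldType) (G : finGroupType) (V : vectType F)
    (rho : {linear drinfeld_double F G -> 'End(V)}) (m : nat) : F :=
  lfun_trace (rho (dd_sweedler_power m (dd_integral F G))).

(* Main.v *)
(* One has nu_m = 1/|G| \sum_u F(u), where F(u) is the sum of the traces of
   p_u >< x^m over the x with (x u^-1)^m = x^m.  As F is a class function, it is
   enough to study each F(u) / |C(u)|.

   Let A = <a, b^q>, an abelian subgroup of index q, and
   S = 1 + n + ... + n^(q-1).  If q does not divide m, then x^m is conjugate to
   a^(m i) b^(m j) for x = a^i b^j.  If m = q M, then x^m = a^(m i) b^(m j) on A,
   while off A it is the central element a^(M S i) b^(m j).  Hence F(u) is an
   integral combination of sums of traces over homomorphic images of groups, and
   each of these is the order of the group times the rank of a projector (onto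
   the invariants).  There remains the divisibility by |C(u)|:
   - for u central, it comes from the eigenspaces of b, whose dimensions differ
     for the two relevant projectors by amounts that are periodic with period l;
   - for u in A not central, C(u) = A and there is nothing to prove;
   - for u not in A and q odd, multiplication by n acts without fixed points on
     (n-1)(Z_k - K), where K = {i | M (q - S) i = 0}, so that q divides the
     cardinality of this set; for q = 2, the x in A contribute a sum over a coset
     of a subgroup of index 2, which can be the nontrivial coset only if 8
     divides k, and then the sum may be negative. *)

Require Import Defs.
From HB Require Import structures.
From mathcomp Require Import all_boot all_order all_fingroup all_algebra.
From mathcomp Require Import all_solvable all_field all_character.
From mathcomp Require Import ring.
From mathcomp Require Import complex.
From mathcomp Require Import reals.

Set Implicit Arguments.
Unset Strict Implicit.
Unset Printing Implicit Defensive.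

Import GRing.Theory Num.Theory.
Local Open Scope ring_scope.

(** * Traces of projectors *)

(** In a full-rank factorization E = C R, cancelling C on the left and R on the right of C R C R = C
    R leaves R C = 1, and C R has the same trace as R C, the identity matrix whose size is the
    rank. *)
Lemma mxtrace_idem (F : fieldType) d (E : 'M[F]_d) :
  E *m E = E -> \tr E = (\rank E)%:R.
Proof.
move=> EE.
have RC1 : row_base E *m col_base E = 1%:M.
  have [[B RB] [C CB]] := (row_freeP (row_base_free E), row_fullP (col_base_full E)).
  have := EE; have := mulmx_base E; move: (col_base E) (row_base E) C B CB RB.
  move=> c r C B CB RB {1 2 3}<- /(congr1 (fun Y => C *m Y *m B)).
  by rewrite !mulmxA CB !mul1mx -!mulmxA RB !mulmx1.
by rewrite -[in LHS](mulmx_base E) mxtrace_mulC RC1 mxtrace1.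
Qed.

(* ['M_d] is a ring for every [d], but only ['M_d.+1] is an algebra. *)
Section MatrixScale.
Variables (F : comPzRingType) (d : nat).
Implicit Types A B : 'M[F]_d.

Lemma mxscalerAl a A B : a *: (A * B) = (a *: A) * B.
Proof. exact: scalemxAl. Qed.

Lemma mxscalerAr a A B : a *: (A * B) = A * (a *: B).
Proof. exact: scalemxAr. Qed.

Lemma mxexprZ a A r : (a *: A) ^+ r = a ^+ r *: A ^+ r.
Proof.
elim: r => [|r IH]; first by rewrite scale1r.
by rewrite !exprS IH -mxscalerAl -mxscalerAr scalerA.
Qed.

End MatrixScale.

Definition is_int (F : pzRingType) (x : F) := exists z : int, x = z%:~R.

Section IsInt.
Variable F : pzRingType.
Implicit Types x y : F.

Lemma is_int_nat n : is_int (n%:R : F).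
Proof. by exists n. Qed.

Lemma is_intD x y : is_int x -> is_int y -> is_int (x + y).
Proof. by case=> [z ->] [t ->]; exists (z + t); rewrite intrD. Qed.

Lemma is_intB x y : is_int x -> is_int y -> is_int (x - y).
Proof. by case=> [z ->] [t ->]; exists (z - t); rewrite intrB. Qed.

Lemma is_intM x y : is_int x -> is_int y -> is_int (x * y).
Proof. by case=> [z ->] [t ->]; exists (z * t); rewrite intrM. Qed.

Lemma is_int_sum I (r : seq I) (P : pred I) (f : I -> F) :
  (forall i, P i -> is_int (f i)) -> is_int (\sum_(i <- r | P i) f i).
Proof. by move=> fi; apply: big_ind => //; [exists 0|exact: is_intD]. Qed.

End IsInt.

Lemma is_int_ge0 (F : numDomainType) (x : F) :
  is_int x -> 0 <= x -> exists n : nat, x = n%:R.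
Proof. by case=> [[n|n] ->]; rewrite ler0z // => _; exists n. Qed.

(* The twisted averages [P t] of the powers of [X] are the projectors onto the
   eigenspaces of [X]; the hypothesis on traces says that the ranks of
   [P t * E] and [P t * E'] differ by an amount which depends only on
   [t] modulo [l]; each residue class modulo [l] occurs [q] times. *)
Section RankDivisibility.
Variables (F : numClosedFieldType) (d : nat).
Implicit Types X Y E : 'M[F]_d.

Lemma idem_cyclic_mean X N : (0 < N)%N -> X ^+ N = 1 ->
  let P := N%:R^-1 *: \sum_(r < N) X ^+ r in P * P = P.
Proof.
move=> N0 XN P.
have XP : X * P = P.
  rewrite /P -mxscalerAr mulr_sumr; congr (_ *: _).
  under eq_bigr do rewrite -exprS.
  case: N N0 XN {P} => // N _ XN.
  by rewrite big_ord_recr [RHS]big_ord_recl /= XN expr0 addrC.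
have XrP r : X ^+ r * P = P.
  by elim: r => [|r IH]; rewrite ?mul1r // exprSr -mulrA XP.
rewrite {1}/P -mxscalerAl mulr_suml (eq_bigr (fun=> P)) => [|r _]; last exact: XrP.
rewrite sumr_const card_ord -scaler_nat scalerA mulVf ?scale1r //.
by rewrite pnatr_eq0 -lt0n.
Qed.

Lemma trace_idemM P E : P * P = P -> E * E = E -> P * E = E * P ->
  exists n : nat, \tr (P * E) = n%:R.
Proof.
move=> PP EE PE; exists (\rank (P * E)%R); apply: mxtrace_idem.
by rewrite -[_ *m _]/((P * E) * (P * E)) mulrA -(mulrA P) -PE mulrA PP -mulrA EE.
Qed.

(** The polynomial X^N - 1 splits and is separable, and its N distinct roots must include a
    primitive one. *)
Lemma prim_root_exists N : (0 < N)%N -> exists w : F, N.-primitive_root w.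
Proof.
move=> N0; pose p : {poly F} := 'X^N - 1.
have [rs] := closed_field_poly_normal p.
rewrite (monicP _) ?monicXnsubC // scale1r => pE.
have rootN : all N.-unity_root rs.
  by apply/allP => z; rewrite -root_prod_XsubC -pE.
have rs_uniq : uniq rs.
  by rewrite -separable_prod_XsubC -pE separable_Xn_sub_1 // pnatr_eq0 -lt0n.
have size_rs : (N <= size rs)%N.
  by rewrite -ltnS -(size_prod_XsubC rs id) -pE size_XnsubC.
by have /hasP[w] := has_prim_root N0 rootN rs_uniq size_rs; exists w.
Qed.

Lemma prim_root_sum0 N (w : F) r : N.-primitive_root w -> (0 < r < N)%N ->
  \sum_(t < N) w ^+ (t * r) = 0.
Proof.
move=> wN /andP[r0 rN].
have w1 : w ^+ r != 1.
  by rewrite -(expr0 w) (eq_prim_root_expr wN) mod0n modn_small // -lt0n.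
apply: (mulfI (x := w ^+ r - 1)); first by rewrite subr_eq0.
rewrite mulr0; under eq_bigr do rewrite mulnC exprM.
by rewrite -subrX1 -exprM mulnC exprM (prim_expr_order wN) expr1n subrr.
Qed.

Lemma trace_idem_sub_divisible q l X E E' : (0 < q)%N -> (0 < l)%N ->
    X ^+ (q * l) = 1 -> E * E = E -> E' * E' = E' ->
    X * E = E * X -> X * E' = E' * X ->
    (forall r, ~~ (q %| r)%N -> \tr (X ^+ r * E) = \tr (X ^+ r * E')) ->
  exists2 z : F, is_int z & \tr E - \tr E' = q%:R * z.
Proof.
move=> q0 l0 XN EE EE' XE XE' trX.
have N0 : (0 < q * l)%N by rewrite muln_gt0 q0.
have [w wN] := prim_root_exists N0.
pose N := (q * l)%N; have NF : N%:R != 0 :> F by rewrite pnatr_eq0 -lt0n.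
pose P t := N%:R^-1 *: \sum_(r < N) (w ^+ t *: X) ^+ r.
have PE t Y : P t * Y = N%:R^-1 *: \sum_(r < N) w ^+ (t * r) *: (X ^+ r * Y).
  rewrite /P -mxscalerAl mulr_suml; congr (_ *: _); apply: eq_bigr => r _.
  by rewrite mxexprZ -exprM -mxscalerAl.
have PP t : P t * P t = P t.
  apply: idem_cyclic_mean => //.
  by rewrite mxexprZ -exprM mulnC exprM (prim_expr_order wN) expr1n scale1r.
have Pc t Y : X * Y = Y * X -> P t * Y = Y * P t.
  move=> XY; rewrite PE /P -mxscalerAr mulr_sumr; congr (_ *: _).
  apply: eq_bigr => r _; rewrite mxexprZ -exprM -mxscalerAr; congr (_ *: _).
  exact/commr_sym/commrX/commr_sym.
have trP Y : \tr Y = \sum_(t < N) \tr (P t * Y).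
  under eq_bigr do rewrite PE mxtraceZ raddf_sum.
  rewrite -mulr_sumr exchange_big /=.
  under eq_bigr => r _.
    under eq_bigr do rewrite mxtraceZ.
    rewrite -mulr_suml; over.
  rewrite (bigD1 (Ordinal N0)) //= [X in _ + X]big1 ?addr0 => [|r].
    under eq_bigr do rewrite muln0 expr0.
    by rewrite sumr_const card_ord mul1r mulrA mulVf // mul1r.
  rewrite -val_eqE /= -lt0n => r0.
  by rewrite prim_root_sum0 ?mul0r // r0 ltn_ord.
pose D t := \tr (P t * E) - \tr (P t * E').
have Dint t : is_int (D t).
  rewrite /D; have [n ->] := trace_idemM (PP t) EE (Pc t _ XE).
  have [n' ->] := trace_idemM (PP t) EE' (Pc t _ XE').
  by apply: is_intB; exact: is_int_nat.
(* Replacing t by t + l multiplies the r-th term by w^(l r), which is 1 if q divides r; for the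
   other r the two traces cancel by hypothesis. *)
have Dper t : D (t + l)%N = D t.
  rewrite /D !PE !mxtraceZ !raddf_sum /= -!mulrBr -!sumrB; congr (_ * _).
  apply: eq_bigr => r _; rewrite !mxtraceZ -!mulrBr.
  have [/dvdnP[c rc]|/trX->] := boolP (q %| r)%N; last by rewrite subrr !mulr0.
  rewrite mulnDl exprD; suff -> : w ^+ (l * r) = 1 by rewrite mulr1.
  by rewrite rc mulnC -mulnA mulnC exprM (prim_expr_order wN) expr1n.
exists (\sum_(t < l) D t); first exact: is_int_sum.
rewrite (trP E) (trP E') -sumrB -/(D _).
have -> (c : nat) : \sum_(i < c * l) D i = c%:R * \sum_(t < l) D t.
  elim: c => [|c IH]; first by rewrite mul0n big_ord0 mul0r.
  rewrite -(big_mkord xpredT D) mulSn (big_cat_nat (n := l)) ?leq_addr //=.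
  rewrite -{2}[l]add0n big_addn addKn !big_mkord -[c.+1]addn1 natrD mulrDl.
  rewrite mul1r addrC.
  by congr (_ + _); rewrite -IH; apply: eq_bigr => i _.
by [].
Qed.

End RankDivisibility.

(** * Indicators of modules over the double *)

Lemma big_tuple_cons (V : nmodType) (T : finType) m (f : m.+1.-tuple T -> V) :
  \sum_t f t = \sum_(b : T) \sum_(t : m.-tuple T) f [tuple of b :: t].
Proof.
rewrite pair_big /= (reindex (fun p : T * m.-tuple T => [tuple of p.1 :: p.2])) //=.
exists (fun t => (thead t, [tuple of behead t])) => [[b t] _|t _] /=.
  by congr (_, _); apply: val_inj.
by rewrite -tuple_eta.
Qed.

(** * Sweedler powers of basis elements and of the integral *)

Section SweedlerPower.
Variables (F : fieldType) (G : finGroupType).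
Notation D := (drinfeld_double F G).
Implicit Types (f : D) (g h x y : G).

Lemma dd_itercomul_lin m (I : finType) (c : I -> F) (f : I -> D) t :
  dd_itercomul m (\sum_i c i *: f i) t = \sum_i c i * dd_itercomul m (f i) t.
Proof.
have : forall b, (\sum_i c i *: f i : D) b = \sum_i c i * f i b.
  by move=> b; rewrite sum_ffunE; apply: eq_bigr => i _; rewrite ffunE.
move: (\sum_i c i *: f i : D) => s sumE.
case: m t => [|m] t /=; rewrite ffunE.
  transitivity (\sum_(b : G * G) \sum_i c i * (f i b * (b.1 == 1%g)%:R)).
    apply: eq_bigr => b _; under eq_bigr do rewrite mulrA.
    by rewrite -mulr_suml; congr (_ * _); exact: sumE.
  rewrite exchange_big; apply: eq_bigr => i _; rewrite ffunE mulr_sumr.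
  by [].
case tE: (thead t) => [g x].
have comulE e : dd_comul s (g, x, e) =
    \sum_i c i * dd_comul (f i) (g, x, e).
  case: e => h y; rewrite dd_comulE.
  under eq_bigr do rewrite dd_comulE mulrA.
  by rewrite -mulr_suml; congr (_ * _); exact: sumE.
under eq_bigr do rewrite comulE mulr_suml.
rewrite exchange_big; apply: eq_bigr => i _; rewrite ffunE mulr_sumr.
by under [RHS]eq_bigr do rewrite tE mulrA.
Qed.

Lemma dd_sweedler_power_lin m (I : finType) (c : I -> F) (f : I -> D) :
  dd_sweedler_power m (\sum_i c i *: f i) =
  \sum_i c i *: dd_sweedler_power m (f i).
Proof.
rewrite /dd_sweedler_power /dd_tensor_mul.
under eq_bigr do rewrite dd_itercomul_lin scaler_suml.
rewrite exchange_big; apply: eq_bigr => i _; rewrite scaler_sumr.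
by apply: eq_bigr => t _; rewrite scalerA.
Qed.

Lemma dd_sweedler_powerS m g x :
  dd_sweedler_power m.+1 (dd_basis F (g, x)) =
  \sum_h dd_basis F (h, x) * dd_sweedler_power m (dd_basis F ((h^-1 * g)%g, x)).
Proof.
rewrite {1}/dd_sweedler_power /dd_tensor_mul big_tuple_cons.
pose c h y := \sum_(t : m.-tuple (G * G))
  dd_itercomul m.+1 (dd_basis F (g, x)) [tuple of (h, y) :: t] *:
    \prod_(b <- [tuple of (h, y) :: t]) dd_basis F b.
rewrite (eq_bigr (fun b => c b.1 b.2)) => [|[]//].
rewrite -(pair_bigA _ c) /=.
apply: eq_bigr => h _; rewrite (bigD1 x) //= [X in _ + X]big1 ?addr0.
  rewrite mulr_sumr; apply: eq_bigr => t _; rewrite big_cons -scalerAr.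
  congr (_ *: _); rewrite ffunE (bigD1 ((h^-1 * g)%g, x)) //= theadE.
  rewrite dd_comulE mulKVg ffunE !eqxx mulr1 mul1r [X in _ + X]big1 ?addr0.
    by congr (dd_itercomul _ _ _); apply: val_inj.
  move=> [h' y]; rewrite dd_comulE ffunE !xpair_eqE /=.
  case: (eqVneq x y) => [<-|_ _].
    by rewrite !eqxx !andbT -(inj_eq (mulgI h)) mulKVg => /negPf ->; rewrite !mul0r.
  by rewrite mulr0 mul0r.
move=> y /negPf yx; apply: big1 => t _; rewrite ffunE theadE.
rewrite big1 ?scale0r // => -[h' z] _.
by rewrite dd_comulE ffunE xpair_eqE yx andbF mul0r mul0r.
Qed.

(** The product of p_h >< x and p_h' >< x^m is nonzero only if h' = h^x, so the surviving legs are
    h, h^x, h^(x^2), ..., whose product is (h x^-1)^m x^m. *)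
Lemma dd_sweedler_power_basis m g x :
  dd_sweedler_power m (dd_basis F (g, x)) =
  \sum_(h | ((h * x^-1) ^+ m * x ^+ m == g)%g) dd_basis F (h, (x ^+ m)%g).
Proof.
elim: m g => [|m IH] g.
  rewrite /dd_sweedler_power /dd_tensor_mul.
  rewrite (bigD1 [tuple]) //= [X in _ + X]big1 ?addr0 => [|t]; last first.
    by rewrite (tuple0 t).
  rewrite ffunE dd_counit_basis big_nil /=.
  under eq_bigl do rewrite !expg0 mulg1 eq_sym.
  case: eqP => _; first by rewrite scale1r.
  by rewrite scale0r big_pred0.
rewrite dd_sweedler_powerS [RHS]big_mkcond /=; apply: eq_bigr => h _.
rewrite IH mulr_sumr (eq_bigr (fun h' => if h' == (h ^ x)%g then
   dd_basis F (h, x ^+ m.+1)%g else 0)).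
  rewrite -big_mkcondr /=.
  have cond : ((h ^ x * x^-1) ^+ m * x ^+ m == h^-1 * g)%g =
      ((h * x^-1) ^+ m.+1 * x ^+ m.+1 == g)%g.
    have -> : (h ^ x * x^-1)%g = ((h * x^-1) ^ x)%g.
      by rewrite !conjgE !mulgA mulgK mulgKV.
    rewrite -conjXg -(inj_eq (mulgI h)) mulKVg conjgE expgS expgS.
    by rewrite !mulgA.
  case: ifP => c; last first.
    by rewrite big1 // => h' /andP[+ /eqP hh]; rewrite hh cond c.
  rewrite (bigD1 (h ^ x)%g) ?cond ?c ?eqxx //= big1 ?addr0 // => h'.
  by case/andP=> /andP[_ /eqP->]; rewrite eqxx.
move=> h' _; rewrite [_ * _]dd_basis_mulE /dd_basis_mul /= expgS.
have -> : (h == x * h' * x^-1)%g = (h' == h ^ x)%g.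
  rewrite conjgE; apply/eqP/eqP => ->.
    by rewrite !mulgA mulVg mul1g mulgKV.
  by rewrite !mulgA mulgV mul1g mulgK.
by case: eqP.
Qed.

Lemma dd_sweedler_power_integral m :
  dd_sweedler_power m (dd_integral F G) =
  #|G|%:R^-1 *: \sum_h \sum_(x | ((x * h^-1) ^+ m == x ^+ m)%g)
     dd_basis F (h, (x ^+ m)%g).
Proof.
rewrite /dd_integral scaler_sumr dd_sweedler_power_lin -scaler_sumr.
congr (_ *: _); under eq_bigr do rewrite dd_sweedler_power_basis.
rewrite (exchange_big_dep xpredT) //=; apply: eq_bigr => h _.
apply: eq_bigl => x.
by rewrite -[(h * x^-1)%g]invgK invMg invgK expgVn -eq_mulVg1.
Qed.

End SweedlerPower.

(* [pi u x] is the matrix of [p_u >< x] in a representation of the double. *)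
Definition double_rep (F : fieldType) (G : finGroupType) d
    (pi : G -> G -> 'M[F]_d) : Prop :=
  (forall u x v y, pi u x * pi v y = pi u (x * y)%g *+ (u == x * v * x^-1)%g)
  /\ \sum_u pi u 1%g = 1.

(* [#|G|^-1 * \sum_u indicator_part pi m u] is the [m]-th indicator. *)
Definition indicator_part (F : fieldType) (G : finGroupType) d
    (pi : G -> G -> 'M[F]_d) (m : nat) (u : G) : F :=
  \sum_(x | ((x * u^-1) ^+ m == x ^+ m)%g) \tr (pi u (x ^+ m)%g).

Section ModuleToMatrices.
Variables (F : fieldType) (G : finGroupType) (V : vectType F).
Variable rho : {linear drinfeld_double F G -> 'End(V)}.
Hypothesis V_module : is_left_module rho.

(* [passmx.mxof] acts on row vectors, hence the transpose *)
Definition endmx (f : 'End(V)) : 'M[F]_(\dim {:V}) :=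
  (passmx.mxof (vbasis {:V}) (vbasis {:V}) f)^T.

Fact endmx_is_linear : linear endmx.
Proof. by move=> a f g; rewrite /endmx passmx.mxof_linear linearP. Qed.

HB.instance Definition _ :=
  GRing.isLinear.Build F 'End(V) 'M[F]_(\dim {:V}) _ endmx endmx_is_linear.

Lemma endmx_comp f g : endmx (f \o g)%VF = endmx f * endmx g.
Proof.
rewrite [RHS](esym (trmx_mul _ _)); congr (_^T).
exact: (passmx.mxof_comp _ _ (vbasisP {:V})).
Qed.

Definition module_mx (u x : G) := endmx (rho (dd_basis F (u, x))).

Lemma module_mx_double_rep : double_rep module_mx.
Proof.
case: V_module => rho1 rhoM; split=> [u x v y|].
  rewrite /module_mx -endmx_comp -rhoM [_ * _]dd_basis_mulE /dd_basis_mul /=.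
  by case: eqP => _; rewrite ?mulr1n // !mulr0n !raddf0.
transitivity (endmx \1%VF); last first.
  by rewrite /endmx passmx.mxof1 ?trmx1 // (basis_free (vbasisP {:V})).
by rewrite -rho1 [1 in RHS]/(dd_one F G) !raddf_sum.
Qed.

Lemma dd_indicatorE m :
  dd_indicator rho m = #|G|%:R^-1 * \sum_u indicator_part module_mx m u.
Proof.
rewrite /dd_indicator dd_sweedler_power_integral linearZ /lfun_trace -mxtrace_tr.
rewrite -/(endmx _) linearZ mxtraceZ; congr (_ * _).
rewrite !raddf_sum; apply: eq_bigr => u _.
by rewrite !raddf_sum.
Qed.

End ModuleToMatrices.

Section DoubleRep.
Variables (F : numClosedFieldType) (G : finGroupType) (d : nat).
Variable pi : G -> G -> 'M[F]_d.
Hypothesis pi_rep : double_rep pi.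
Let piM := proj1 pi_rep.
Let pi1 := proj2 pi_rep.
Implicit Types u x y : G.

Lemma double_repM u x y : commute u x -> pi u x * pi u y = pi u (x * y)%g.
Proof. by move=> ux; rewrite piM -ux mulgK eqxx. Qed.

(** This is the action of x through the embedding of the group algebra in the double. *)
Definition group_mx x := \sum_u pi u x.

Lemma group_mxM x y : group_mx x * group_mx y = group_mx (x * y)%g.
Proof.
rewrite /group_mx mulr_suml; apply: eq_bigr => u _.
rewrite mulr_sumr (bigD1 (u ^ x)%g) //= piM ?conjgE !mulgA mulgV mul1g mulgK eqxx.
rewrite big1 ?addr0 // => v vux; rewrite piM; case: eqP => // uE.
by case/eqP: vux; rewrite uE ?conjgE !mulgA mulVg mul1g mulgKV.
Qed.

Lemma group_mxX x n : group_mx x ^+ n = group_mx (x ^+ n)%g.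
Proof. by elim: n => [|n IH]; rewrite ?expr0 ?expg0 // exprS expgS IH group_mxM. Qed.

Lemma group_mx1 : group_mx 1 = 1.
Proof. exact: pi1. Qed.

Lemma group_mx_pi y u x : group_mx y * pi u x = pi (u ^ y^-1)%g (y * x)%g.
Proof.
rewrite /group_mx mulr_suml (bigD1 (u ^ y^-1)%g) //= piM ?conjgE invgK mulgA eqxx.
rewrite big1 ?addr0 // => v vuy; rewrite piM; case: eqP => // vE.
by case/eqP: vuy; rewrite vE.
Qed.

Lemma pi_group_mx y u x : pi u x * group_mx y = pi u (x * y)%g.
Proof.
rewrite /group_mx mulr_sumr (bigD1 (u ^ x)%g) //= piM ?conjgE !mulgA mulgV mul1g.
rewrite mulgK eqxx big1 ?addr0 // => v vux; rewrite piM; case: eqP => // uE.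
by case/eqP: vux; rewrite uE ?conjgE !mulgA mulVg mul1g mulgKV.
Qed.

Lemma tr_double_repJ u x y : \tr (pi (u ^ y) (x ^ y))%g = \tr (pi u x).
Proof.
have -> : pi (u ^ y)%g (x ^ y)%g = group_mx y^-1 * (pi u x * group_mx y).
  by rewrite pi_group_mx group_mx_pi invgK conjgE.
rewrite [LHS]mxtrace_mulC -[_ *m _]/((_ * _) * _) -mulrA group_mxM mulgV.
by rewrite group_mx1 mulr1.
Qed.

Lemma indicator_partJ m u y :
  indicator_part pi m (u ^ y)%g = indicator_part pi m u.
Proof.
rewrite /indicator_part (reindex_inj (conjg_inj y)) /=.
apply: eq_big => [x|x _].
  by rewrite -conjVg -conjMg -!conjXg (inj_eq (conjg_inj y)).
by rewrite -conjXg tr_double_repJ.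
Qed.

(** The class of u contributes |G| / |C(u)| equal terms. *)
Lemma mean_indicator_part m :
  #|G|%:R^-1 * \sum_u indicator_part pi m u =
  \sum_(uG in classes [set: G])
    indicator_part pi m (repr uG) / #|'C[repr uG]%g|%:R.
Proof.
have -> : \sum_u indicator_part pi m u = \sum_(u in [set: G]) indicator_part pi m u.
  by apply: eq_bigl => u; rewrite inE.
rewrite sum_by_classes => [|u v _ _]; last exact: indicator_partJ.
rewrite mulr_sumr; apply: eq_bigr => uG /imsetP[u _ ->{uG}].
have [v _ ->] := repr_class [set: G] u.
rewrite mulrA mulrC; congr (_ * _).
have classG : (u ^ v ^: [set: G] = u ^: [set: G])%g by rewrite classGidl ?inE.
rewrite -classG -index_cent1 setTI.
apply: (mulfI (x := #|'C[(u ^ v)%g]%g|%:R)).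
  by rewrite pnatr_eq0 -lt0n cardG_gt0.
rewrite mulfV ?pnatr_eq0 -?lt0n ?cardG_gt0 // mulrCA -natrM Lagrange ?subsetT //.
by rewrite cardsT mulVf // pnatr_eq0 -lt0n; apply/card_gt0P; exists 1%g.
Qed.

End DoubleRep.

(** * Normal forms in the semidirect product *)

Lemma val_ZpD N (x y : 'Z_N) : (1 < N)%N -> ((x + y)%R = (x + y) %% N :> nat)%N.
Proof.
move=> N1; transitivity ((x + y) %% (Zp_trunc N).+2)%N => //.
by rewrite [X in (_ %% X)%N]Zp_cast.
Qed.

Section SemidirectModel.
Variables (k N n : nat).
Hypotheses (k_gt1 : (1 < k)%N) (N_gt1 : (1 < N)%N).
Hypothesis nN : (n%:R : 'Z_k) ^+ N = 1.
Notation T := ('Z_k * 'Z_N)%type.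
Let nu : 'Z_k := n%:R.

(* Right multiplication by [a] and [b] on normal forms [a^x b^y]. *)
Let fa (p : T) : T := (p.1 + nu ^+ p.2, p.2).
Let fb (p : T) : T := (p.1, p.2 + 1).

Let fa_inj : injective fa.
Proof.
move=> [x y] [x' y'] e; have /= yy := congr1 snd e.
by have := congr1 fst e; rewrite /= yy => /addIr ->.
Qed.
Let fb_inj : injective fb.
Proof.
move=> [x y] [x' y'] e; have /= /addIr -> := congr1 snd e.
by have /= -> := congr1 fst e.
Qed.
Let pa := perm fa_inj.
Let pb := perm fb_inj.

Let paX c x y : (pa ^+ c)%g (x, y) = (x + nu ^+ y *+ c, y).
Proof.
elim: c => [|c IH]; first by rewrite expg0 perm1 mulr0n addr0.
by rewrite expgSr permM IH permE /fa /= -addrA -mulrSr.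
Qed.

Let pbX c x y : (pb ^+ c)%g (x, y) = (x, y + c%:R).
Proof.
elim: c => [|c IH]; first by rewrite expg0 perm1 addr0.
by rewrite expgSr permM IH permE /fb /= -addrA -mulrSr.
Qed.

Let nuS (y : 'Z_N) : nu ^+ (y + 1)%R = nu * nu ^+ y.
Proof.
rewrite val_ZpD // (expr_mod _ nN) [X in (_ + X)%N](_ : _ = 1%N) ?addn1 ?exprS //.
Qed.

(** The relations only bound the order of the presented group from above; this permutation group
    supplies the lower bound. *)
Lemma semidirect_model : exists (rT : finGroupType) (H : {group rT}),
  (H \homg Grp (a : b : a ^+ k, b ^+ N, b * a * b^-1 = a ^+ n))%g /\
  (k * N <= #|H|)%N.
Proof.
exists {perm T}, (<[pa]> <*> <[pb]>)%G; split.
  apply/existsP; exists (pa, pb); rewrite /= !xpair_eqE eqxx /=.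
  apply/and3P; split.
  - apply/eqP/permP=> -[x y].
    by rewrite paX perm1 -mulr_natr pchar_Zp // mulr0 addr0.
  - by apply/eqP/permP=> -[x y]; rewrite pbX perm1 pchar_Zp // addr0.
  suff -> : (pb * pa = pa ^+ n * pb)%g by rewrite mulgK.
  apply/permP=> -[x y]; rewrite !permM paX [pb _]permE permE /fa /= /fb /=.
  by rewrite permE /fb /= nuS -mulr_natl.
pose f (p : T) := (pa ^+ p.1 * pb ^+ p.2)%g.
have f_inj : injective f.
  (* Evaluation at (0, 0), the normal form of the identity, recovers p. *)
  have fE p : f p (0, 0) = p.
    by rewrite /f permM paX pbX expr0 !add0r !natr_Zp -surjective_pairing.
  by move=> p p' /(congr1 (fun s : {perm T} => s (0, 0))); rewrite !fE.
have -> : (k * N = #|f @: [set: T]|)%N.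
  by rewrite card_imset // cardsT card_prod !card_ord !Zp_cast.
apply: subset_leq_card; apply/subsetP => _ /imsetP[p _ ->].
by rewrite groupM // groupX // mem_gen // inE cycle_id ?orbT.
Qed.

End SemidirectModel.

(** The map is onto because b normalizes <a>; it is then bijective by counting, since the model
    group, of order at least k N, is a quotient of G. *)
Lemma presentation_normal_form k N n (G : finGroupType) :
    (1 < k)%N -> (1 < N)%N -> (n%:R : 'Z_k) ^+ N = 1 ->
    ([set: G] \isog
       Grp (a : b : a ^+ k, b ^+ N, b * a * b^-1 = a ^+ n))%g ->
  exists a b : G,
    [/\ (a ^+ k = 1)%g, (b ^+ N = 1)%g, (b * a * b^-1 = a ^+ n)%g &
        bijective (fun p : 'Z_k * 'Z_N => (a ^+ p.1 * b ^+ p.2)%g)].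
Proof.
move=> k1 N1 nN isoG.
have /existsP[[a b]] := isoGrp_hom isoG.
rewrite /= !xpair_eqE => /and4P[/eqP defG /eqP ak /eqP bN /eqP ab].
exists a, b; split=> //.
set f := fun p => _.
have fsurj x : exists p, f p == x.
  have : x \in (<[a]> * <[b]>)%g.
    rewrite -norm_joinEr ?defG ?inE // cycle_subG -groupV inE.
    by rewrite -cycleJ cycle_subG conjgE invgK mulgA ab mem_cycle.
  case/mulsgP=> _ _ /cycleP[i ->] /cycleP[j ->] ->.
  exists (i%:R, j%:R); rewrite /f /= !val_Zp_nat //.
  by rewrite (expg_mod _ ak) (expg_mod _ bN).
pose g x := xchoose (fsurj x).
have fg : cancel g f by move=> x; apply/eqP; exact: (xchooseP (fsurj x)).
have [rT [H [homH cardH]]] := semidirect_model k1 N1 nN.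
have cardG : (#|{: 'Z_k * 'Z_N}| <= #|G|)%N.
  rewrite card_prod !card_ord !Zp_cast // (leq_trans cardH) // -cardsT.
  by rewrite dvdn_leq ?cardG_gt0 // card_homg // isoG.
have [h gh hg] := inj_card_bij (can_inj fg) cardG.
by exists g => // p; rewrite -[p]hg fg.
Qed.

(** * Arithmetic modulo k *)

Section Geometric.
Variable R : comNzRingType.
Implicit Types x z : R.

Definition geo x m := \sum_(c < m) x ^+ c.

Lemma geoS x m : geo x m.+1 = 1 + x * geo x m.
Proof.
rewrite /geo big_ord_recl expr0 mulr_sumr; congr (_ + _).
by apply: eq_bigr => c _; rewrite -exprS.
Qed.

Lemma geo1 m : geo 1 m = m%:R.
Proof. by rewrite /geo (eq_bigr _ (fun _ _ => expr1n _ _)) sumr_const card_ord. Qed.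

Lemma geo_nat x m : exists y, geo x m = m%:R + (x - 1) * y.
Proof.
elim: m => [|m [y IH]]; first by exists 0; rewrite /geo big_ord0 mulr0 addr0.
by exists (geo x m + y); rewrite geoS -natr1 [in LHS]IH [in RHS]IH; ring.
Qed.

Lemma geo_taylor z m :
  exists w, geo (1 + z) m = m%:R + z * 'C(m, 2)%:R + z ^+ 2 * w.
Proof.
elim: m => [|m [w IH]]; first by exists 0; rewrite /geo big_ord0 bin0n !mulr0 !addr0.
exists ('C(m, 2)%:R + w + z * w); rewrite geoS IH binS bin1 natrD -natr1; ring.
Qed.

End Geometric.

Section RootOfUnity.
Variables (R : comNzRingType) (q : nat) (nu : R).
Hypotheses (q_prime : prime q) (nuq : nu ^+ q = 1).
Notation S := (geo nu q).

Lemma nu_geo : nu * S = S.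
Proof.
by apply/eqP; rewrite -subr_eq0 -[X in _ - X]mul1r -mulrBl -subrX1 nuq subrr.
Qed.

Lemma nuX_geo j : nu ^+ j * S = S.
Proof. by elim: j => [|j IH]; rewrite ?mul1r // exprSr -mulrA nu_geo. Qed.

Lemma geo_mul_self : S * S = q%:R * S.
Proof.
rewrite {1}/geo mulr_suml (eq_bigr (fun=> S)) => [|c _]; last exact: nuX_geo.
by rewrite sumr_const card_ord mulr_natl.
Qed.

Lemma nuX_dvd j : (q %| j)%N -> nu ^+ j = 1.
Proof. by case/dvdnP=> c ->; rewrite mulnC exprM nuq expr1n. Qed.

Lemma nuX_sub1 j : exists y, nu ^+ j - 1 = (nu - 1) * y.
Proof. by exists (geo nu j); rewrite -subrX1. Qed.

(** As j is invertible modulo q, nu is a power of nu^j. With [nuX_sub1], nu - 1 and nu^j - 1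
    generate the same ideal. *)
Lemma sub1_nuX j : ~~ (q %| j)%N -> exists y, nu - 1 = (nu ^+ j - 1) * y.
Proof.
move=> qj; have j0 : (0 < j)%N by case: j qj; rewrite ?dvdn0.
have /eqP jq : coprime j q by rewrite coprime_sym prime_coprime.
have [c d cd _] := egcdnP q j0.
exists (geo (nu ^+ j) c); rewrite -subrX1 -exprM mulnC cd jq addn1 exprS.
by rewrite nuX_dvd ?mulr1 // dvdn_mull.
Qed.

(** Multiplication by j permutes the exponents modulo q, so each of the M blocks of q consecutive
    terms sums to S. *)
Lemma geo_nuX j M : ~~ (q %| j)%N -> geo (nu ^+ j) (q * M) = M%:R * S.
Proof.
move=> qj; have q0 := prime_gt0 q_prime.
have geo_j : geo (nu ^+ j) q = S.
  have h_inj : injective (fun c : 'I_q => Ordinal (ltn_pmod (j * c) q0)).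
    move=> c d /(congr1 val) /= /eqP; wlog le_cd : c d / (c <= d)%N.
      move=> IH; case/orP: (leq_total c d) => [|dc]; first exact: IH.
      by rewrite eq_sym => /(IH _ _ dc).
    rewrite eq_sym eqn_mod_dvd ?leq_mul2l ?le_cd ?orbT // -mulnBr Euclid_dvdM //.
    rewrite (negPf qj) /= => qdc; apply/val_inj/eqP; rewrite eqn_leq le_cd /=.
    rewrite -subn_eq0; apply: contraLR qdc; rewrite -lt0n => cd.
    by rewrite gtnNdvd // (leq_ltn_trans (leq_subr _ _)).
  rewrite [RHS]/geo (reindex_inj h_inj) /=; apply: eq_bigr => c _.
  by rewrite expr_mod // exprM.
elim: M => [|M IH]; first by rewrite muln0 /geo big_ord0 mul0r.
rewrite mulnS /geo big_split_ord /= -/(geo _ q) geo_j -natr1 mulrDl mul1r addrC.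
congr (_ + _); rewrite -IH; apply: eq_bigr => c _.
by rewrite exprD -[in X in X * _]exprM mulnC exprM nuq expr1n mul1r.
Qed.

End RootOfUnity.

Section ModularOrder.
Variables (k q n : nat).
Hypotheses (k_gt1 : (1 < k)%N) (q_prime : prime q).
Notation R := 'Z_k.
Let nu : R := n%:R.
Hypothesis nuq : nu ^+ q = 1.
Notation S := (geo nu q).

Lemma Zp_nat_eq0 (c : nat) : (c%:R == 0 :> R) = (k %| c)%N.
Proof. by rewrite -val_eqE /= val_Zp_nat. Qed.

(** Fermat gives n^q = n modulo q, while n^q = 1 modulo k, hence modulo q. *)
Lemma nu_mod_q : (q %| k)%N -> exists x : nat, nu = 1 + q%:R * x%:R.
Proof.
move=> qk; exists (n %/ q)%N; rewrite /nu [in LHS](divn_eq n q) natrD natrM.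
suff -> : (n %% q = 1)%N by rewrite addrC mulrC.
rewrite -[RHS](modn_small (prime_gt1 q_prime)) -(fermat_little n q_prime).
have : (n ^ q)%N = 1 %[mod k].
  have : (n ^ q)%:R = 1%:R :> R by rewrite natrX.
  by move/(congr1 (@nat_of_ord _)); rewrite !val_Zp_nat.
by move/(congr1 (modn^~ q)); rewrite !modn_dvdm.
Qed.

(* [1 - q c] vanishes modulo the prime-to-[q] part of [k]. *)
Lemma q_part_idem : exists (e : nat) (c : R),
  q%:R ^+ e * (1 - q%:R * c) = 0 /\ (~~ (q %| k)%N -> e = 0%N).
Proof.
have k0 := ltnW k_gt1.
pose k' := (k`_q^')%N; have k'0 : (0 < totient k')%N by rewrite totient_gt0 part_gt0.
(* With this c, q c is q^phi(k'), which is 1 modulo k' by Euler; q^e takes care of the q-part of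
   k. *)
exists (logn q k), (q%:R ^+ (totient k').-1); split; last first.
  by move=> qk; apply/eqP; rewrite lognE q_prime k0 (negPf qk).
have q0 : (0 < q ^ totient k')%N by rewrite expn_gt0 prime_gt0.
apply/eqP; rewrite -exprS prednK // -opprB mulrN oppr_eq0 -!natrX.
rewrite -[X in _ - X]/(1%:R) -natrB // -natrM Zp_nat_eq0.
rewrite -{1}(partnC q k0) p_part dvdn_pmul2l ?expn_gt0 ?prime_gt0 //.
rewrite -eqn_mod_dvd // Euler_exp_totient //.
by rewrite prime_coprime // -p'natE // part_pnat.
Qed.

Section OddOrder.
Hypothesis q_odd : odd q.

(** The factor 1 - q c localizes at the q-part of k, where nu = 1 + q x. There q - S is a multiple
    of q^2 x, since the odd q divides C(q, 2), and (nu - 1) S = 0 says that q^2 x times 1 plus a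
    nilpotent vanishes. *)
Lemma geo_odd_q_part (e : nat) (c : R) :
    q%:R ^+ e * (1 - q%:R * c) = 0 -> (~~ (q %| k)%N -> e = 0%N) ->
  (1 - q%:R * c) * (q%:R - S) = 0.
Proof.
move=> dK; have [qk _|_ /(_ isT) e0] := boolP (q %| k)%N; last first.
  by move: dK; rewrite e0 mul1r => ->; rewrite mul0r.
have [x nuE] : exists x : R, nu = 1 + q%:R * x.
  by have [x nuE] := nu_mod_q qk; exists x%:R.
have [w SE] := geo_taylor (q%:R * x) q.
have [h hE] : exists h : R, 'C(q, 2)%:R = q%:R * h.
  by exists q.-1./2%:R; rewrite bin2odd // natrM.
pose y := (1 - q%:R * c) * (q%:R ^+ 2 * x).
have nuS : (nu - 1) * S = 0 by rewrite mulrBl mul1r nu_geo ?subrr.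
have yE : y = - (q%:R * x * (h + x * w)) * y.
  apply/eqP; rewrite -subr_eq0; apply/eqP.
  transitivity ((1 - q%:R * c) * ((nu - 1) * S)); last by rewrite nuS mulr0.
  by rewrite nuE SE hE /y; ring.
(* Iterating [yE] e times produces the factor q^e, which annihilates 1 - q c. *)
have {yE} y0 : y = 0.
  have yX i : y = (- (q%:R * x * (h + x * w))) ^+ i * y.
    by elim: i => [|i IH]; rewrite ?mul1r // exprSr -mulrA -yE.
  rewrite (yX e) /y exprNn !exprMn.
  transitivity (q%:R ^+ e * (1 - q%:R * c) *
    ((-1) ^+ e * x ^+ e * (h + x * w) ^+ e * (q%:R ^+ 2 * x))); first by ring.
  by rewrite dK mul0r.
transitivity (- y * (h + x * w)); last by rewrite y0 oppr0 mul0r.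
by rewrite nuE SE hE /y; ring.
Qed.

(** The witness is S / q on the prime-to-q part of k, and 1 on the q-part, where S equals q. It
    serves to write multiples of M S as q M times elements killed by M (q - S). *)
Lemma geo_divisible : exists r : R, q%:R * r = S /\ r * (q%:R - S) = 0.
Proof.
have [e [c [dK e0]]] := q_part_idem.
have dS := geo_odd_q_part dK e0.
exists (1 - q%:R * c + S * c); split.
  transitivity (S + (1 - q%:R * c) * (q%:R - S)); first by ring.
  by rewrite dS addr0.
rewrite mulrDl dS add0r mulrAC -[S * (_ - _)]mulrC mulrBl geo_mul_self //.
by rewrite subrr mul0r.
Qed.

End OddOrder.

(* For [q = 2] and [8 %| k] this fails: when [k = 8] and [n = 5] one has [S = 6]
   and [2 - S = 4 = 2 * S]. *)
Lemma geo_ideal_cap (al be : R) : q <> 2 \/ ~~ (8 %| k)%N ->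
  al * (q%:R - S) = be * S -> al * (q%:R - S) = 0.
Proof.
move=> q8 yE; set y := al * _ in yE *.
(* As a multiple of q - S, y is killed by S; as a multiple of S, it is killed by q - S; hence it is
   killed by their sum q. *)
have qy : q%:R * y = 0.
  transitivity (y * S + y * (q%:R - S)); first by ring.
  rewrite {2}yE /y -!mulrA [(_ - _) * S]mulrC mulrBr geo_mul_self //.
  by rewrite [S * _]mulrC subrr !mulr0 addr0.
have [q2|/eqP q2] := eqVneq q 2; last first.
  have q_odd : odd q by case/even_prime: q_prime.
  have [e [c [dK e0]]] := q_part_idem.
  have dS := geo_odd_q_part q_odd dK e0.
  transitivity ((1 - q%:R * c) * y); last by rewrite /y mulrCA dS mulr0.
  by rewrite mulrBl mul1r mulrAC qy mul0r subr0.
have {q8} k8 : ~~ (8 %| k)%N by case: q8.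
have y2 : 2%:R * y = 0 by move: (qy); rewrite [X in X%:R]q2.
have SE : S = 1 + nu by rewrite q2 /geo !big_ord_recl big_ord0 addr0 expr0 expr1.
(* For odd k, 2 y = 0 already gives y = 0. Otherwise nu = 1 + 2 c, and 4 divides S = 2 + 2 c if c is
   odd, but 2 - S = - 2 c if c is even. *)
have [z yz] : exists z, y = 4%:R * z.
  have [k_even|k_odd] := boolP (2 %| k)%N; last first.
    exists 0; rewrite mulr0; have := pchar_Zp k_gt1.
    move: k_odd; rewrite dvdn2 negbK => k_odd.
    rewrite -[X in X%:R](odd_double_half k) k_odd natrD -mul2n natrM.
    move/(congr1 ( *%R^~ y)); rewrite mulrDl mul1r mul0r mulrAC.
    by rewrite y2 mul0r addr0.
  have [c nuE] : exists c : nat, nu = 1 + 2%:R * c%:R.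
    by have [|c] := nu_mod_q; rewrite q2 //; exists c.
  have cE := odd_double_half c; case: (odd c) cE => /= cE.
    exists (be * (1 + (c./2)%:R)); rewrite yE SE nuE -{1}cE -muln2 natrD natrM.
    by ring.
  exists (- al * (c./2)%:R); rewrite /y SE nuE q2 -{1}cE -muln2 natrD natrM.
  by ring.
pose k' := (k`_2^')%N.
(* As 8 does not divide k, 4 k' is a multiple of k. Being killed by 2 and by the odd number k', y
   vanishes. *)
have k'y : k'%:R * y = 0.
  rewrite yz mulrA -natrM; apply/eqP; rewrite [X in X * _](_ : _ = 0) ?mul0r //.
  apply/eqP; rewrite Zp_nat_eq0 -{1}(partnC 2%N (ltnW k_gt1)) mulnC.
  rewrite dvdn_pmul2l ?part_gt0 // p_part -[4%N]/(2 ^ 2)%N dvdn_exp2l //.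
  by rewrite leqNgt -pfactor_dvdn // ltnW.
have k'_odd : odd k'.
  by have := part_pnat (2%N)^' k; rewrite p'natE // dvdn2 negbK.
move: k'y; rewrite -[X in X%:R](odd_double_half _) k'_odd natrD -mul2n natrM.
by rewrite mulrDl mul1r mulrAC y2 mul0r addr0.
Qed.

End ModularOrder.

(** * Counting and averaging *)

Section Counting.
Variable R : finComNzRingType.
Implicit Types (c x y : R) (D : {set R}).

Definition annihilator c := [set x | c * x == 0].

Lemma card_mul_fibers c D :
    (forall x y, c * y = 0 -> x \in D -> x + y \in D) ->
  #|D| = (#|annihilator c| * #|[set (c * x)%R | x in D]|)%N.
Proof.
move=> stabD; rewrite -sum1_card (partition_big_imset (fun x => c * x)) /=.
rewrite mulnC -sum_nat_const; apply: eq_bigr => _ /imsetP[x xD ->].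
rewrite sum1_card -[RHS](card_imset _ (addrI x)); apply: eq_card => y.
apply/idP/imsetP => [/andP[yD /eqP cxy]|[z + ->]].
  exists (y - x); last by rewrite addrC subrK.
  by rewrite inE mulrBr cxy subrr.
rewrite inE => /eqP cz; apply/andP; split; first exact: stabD.
by rewrite mulrDr cz addr0.
Qed.

Lemma root_of_unity_inj (nu : R) q : (0 < q)%N -> nu ^+ q = 1 ->
  injective ( *%R nu).
Proof.
move=> q0 nuq x y /(congr1 ( *%R (nu ^+ q.-1))).
by rewrite !mulrA -exprSr prednK // nuq !mul1r.
Qed.

(** Multiplication by nu generates a q-group acting on W without fixed points. *)
Lemma free_mul_card (nu : R) q (W : {set R}) : prime q -> nu ^+ q = 1 ->
    (forall x, x \in W -> nu * x \in W) ->
    (forall x, x \in W -> nu * x != x) ->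
  (q %| #|W|)%N.
Proof.
move=> q_prime nuq stabW freeW.
pose p := perm (root_of_unity_inj (prime_gt0 q_prime) nuq).
have pX (c : nat) x : (p ^+ c)%g x = nu ^+ c * x.
  elim: c => [|c IH]; first by rewrite expg0 perm1 mul1r.
  by rewrite expgSr permM IH permE /= exprS mulrA.
have pq : (p ^+ q = 1)%g by apply/permP => x; rewrite pX nuq mul1r perm1.
have p_group : (q.-group <[p]>)%g.
  rewrite /pgroup -orderE; apply: pnat_dvd (pnat_id q_prime).
  by rewrite order_dvdn pq.
have p_acts : [acts <[p]>, on W | 'P]%g.
  rewrite cycle_subG; apply/astabsP=> x /=; rewrite apermE permE /=.
  apply/idP/idP => [|/stabW//]; move=> nuxW.
  have stabX (c : nat) y : y \in W -> nu ^+ c * y \in W.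
    by elim: c y => [|c IH] y yW; rewrite ?mul1r // exprSr -mulrA IH ?stabW.
  have := stabX q.-1 _ nuxW.
  by rewrite mulrA -exprSr prednK ?prime_gt0 // nuq mul1r.
have := pgroup_fix_mod p_group p_acts.
suff -> : 'Fix_(W | 'P)(<[p]>)%g = set0.
  by rewrite cards0 mod0n => /eqP; rewrite -/(dvdn _ _).
apply/setP => x; rewrite afix_cycle !inE; apply/negbTE; apply/negP.
by case/andP=> /freeW xW; rewrite sub1set inE /= apermE permE /= (negPf xW).
Qed.

End Counting.

Lemma addr_closed_mem (A : finZmodType) (P : {set A}) x y :
    (forall x y, x \in P -> y \in P -> x - y \in P) -> y \in P ->
  (x + y \in P) = (x \in P).
Proof.
move=> PB yP; apply/idP/idP => [xyP|xP]; first by rewrite -(addrK y x) PB.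
by rewrite -[y]opprK PB // -[- y]add0r -(subrr y) !PB ?subrr.
Qed.

(* Both sides are the sum of [g (f1 x + f2 y)] over [x \in P1], [y \in P2]. *)
Lemma same_image_sum (V X : nmodType) (A1 A2 : finZmodType) (P1 : {set A1})
    (P2 : {set A2}) (f1 : A1 -> X) (f2 : A2 -> X) (g : X -> V) :
    {morph f1 : x y / x + y} -> {morph f2 : x y / x + y} ->
    (forall x y, x \in P1 -> y \in P1 -> x - y \in P1) ->
    (forall x y, x \in P2 -> y \in P2 -> x - y \in P2) ->
    (forall x, x \in P1 -> exists2 y, y \in P2 & f1 x = f2 y) ->
    (forall y, y \in P2 -> exists2 x, x \in P1 & f2 y = f1 x) ->
  (\sum_(x in P1) g (f1 x)) *+ #|P2| = (\sum_(y in P2) g (f2 y)) *+ #|P1|.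
Proof.
move=> f1D f2D P1B P2B im12 im21.
rewrite -!sumr_const.
transitivity (\sum_(y in P2) \sum_(x in P1) g (f1 x + f2 y)).
  apply: eq_bigr => y /im21[x0 x0P ->].
  rewrite (reindex_inj (addIr x0)) /=; apply: eq_big => [x|x _]; last by rewrite f1D.
  exact: addr_closed_mem.
rewrite exchange_big /=; apply: eq_bigr => x /im12[y0 y0P ->].
rewrite [RHS](reindex_inj (addIr y0)) /=.
by apply: eq_big => [y|y _]; rewrite ?addr_closed_mem // f2D addrC.
Qed.

Lemma idem_mean (F : fieldType) d (A : finZmodType) (P : {set A})
    (s : A -> 'M[F]_d) :
    #|P|%:R != 0 :> F -> (forall x y, x \in P -> y \in P -> x - y \in P) ->
    (forall x y, x \in P -> y \in P -> s (x + y) = s x * s y) ->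
  let E := #|P|%:R^-1 *: \sum_(x in P) s x in E * E = E.
Proof.
move=> P0 PB sD E.
have xE x : x \in P -> s x * E = E.
  move=> xP; rewrite /E -[_ * _]scalemxAr; congr (_ *: _).
  rewrite -[_ *m _]/(_ * _) mulr_sumr [RHS](reindex_inj (addrI x)) /=.
  apply: eq_big => [y|y yP]; last by rewrite sD.
  by rewrite addrC addr_closed_mem.
rewrite {1}/E -[_ * _]scalemxAl -[_ *m _]/(_ * _) mulr_suml (eq_bigr _ xE).
by rewrite sumr_const -scaler_nat scalerA mulVf ?scale1r.
Qed.

(** * Indicators of the semidirect product *)

Section SemidirectProduct.
Variables (k q l n : nat) (G : finGroupType) (a b : G).
Hypotheses (k_gt1 : (1 < k)%N) (l_gt0 : (0 < l)%N) (q_prime : prime q).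
Notation N := (q * l)%N.
Notation R := 'Z_k.
Let nu : R := n%:R.
Hypothesis nuq : nu ^+ q = 1.
Hypotheses (ak : (a ^+ k = 1)%g) (bN : (b ^+ N = 1)%g).
Hypothesis ab : (b * a * b^-1 = a ^+ n)%g.
Hypothesis bij_ab : bijective (fun p : 'Z_k * 'Z_N => (a ^+ p.1 * b ^+ p.2)%g).

Definition elt (i : R) (j : 'Z_N) : G := (a ^+ i * b ^+ j)%g.
Notation S := (geo nu q).

Lemma N_gt1 : (1 < N)%N.
Proof. by rewrite (leq_trans (prime_gt1 q_prime)) // leq_pmulr. Qed.

Lemma nuN : nu ^+ N = 1.
Proof. by rewrite exprM nuq expr1n. Qed.

Lemma nuXD (j j' : 'Z_N) : nu ^+ (j + j')%R = nu ^+ j * nu ^+ j'.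
Proof. by rewrite val_ZpD ?N_gt1 // (expr_mod _ nuN) exprD. Qed.

Lemma val_Zp_mulrn (j : 'Z_N) m : j *+ m = (j * m %% N)%N :> nat.
Proof. by rewrite -[j in LHS]natr_Zp -mulrnA val_Zp_nat ?N_gt1. Qed.

Lemma nuX_mulrn (j : 'Z_N) m : nu ^+ (j *+ m)%R = (nu ^+ j) ^+ m.
Proof. by rewrite val_Zp_mulrn (expr_mod _ nuN) exprM. Qed.

Lemma dvdq_mod c : (q %| c %% N)%N = (q %| c)%N.
Proof. by rewrite /dvdn modn_dvdm ?dvdn_mulr. Qed.

Lemma dvdqD (j j' : 'Z_N) : (q %| (j + j')%R)%N = (q %| j + j')%N.
Proof. by rewrite val_ZpD ?N_gt1 // dvdq_mod. Qed.

Lemma dvdq_mulrn (j : 'Z_N) m : (q %| (j *+ m)%R)%N = (q %| j * m)%N.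
Proof. by rewrite val_Zp_mulrn dvdq_mod. Qed.

Lemma aXD (i i' : R) : (a ^+ (i + i')%R = a ^+ i * a ^+ i')%g.
Proof. by rewrite val_ZpD // expg_mod // expgD. Qed.

Lemma bXD (j j' : 'Z_N) : (b ^+ (j + j')%R = b ^+ j * b ^+ j')%g.
Proof. by rewrite val_ZpD ?N_gt1 // expg_mod // expgD. Qed.

Lemma aX_mul_nat (i : R) c : (a ^+ (i * c%:R)%R = (a ^+ i) ^+ c)%g.
Proof.
by rewrite -[i in LHS]natr_Zp -natrM val_Zp_nat // expg_mod // expgM.
Qed.

Lemma bX_aX c (i : R) : (b ^+ c * a ^+ i = a ^+ (nu ^+ c * i)%R * b ^+ c)%g.
Proof.
have ba (i' : R) : (b * a ^+ i' = a ^+ (nu * i')%R * b)%g.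
  rewrite mulrC aX_mul_nat -expgM mulnC expgM -ab.
  elim: (nat_of_ord i') => [|c' IH]; first by rewrite !expg0 mulg1 mul1g.
  by rewrite !expgS -[RHS]mulgA -IH !mulgA mulgKV.
elim: c i => [|c IH] i; first by rewrite expg0 mul1r mulg1 mul1g.
by rewrite expgSr -mulgA ba mulgA IH -mulgA exprSr mulrA.
Qed.

Lemma elt_inj i j i' j' : elt i j = elt i' j' -> i = i' /\ j = j'.
Proof. by move=> /(bij_inj bij_ab (x1 := (i, j)) (x2 := (i', j'))) []. Qed.

Lemma eltP x : exists i j, x = elt i j.
Proof. by have [h _ hK] := bij_ab; exists (h x).1, (h x).2; rewrite [RHS]hK. Qed.

Lemma elt_eq i j i' j' : (elt i j == elt i' j') = (i == i') && (j == j').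
Proof.
by apply/eqP/andP => [/elt_inj[-> ->]|[/eqP-> /eqP->]].
Qed.

Lemma eltM i j i' j' :
  (elt i j * elt i' j')%g = elt (i + nu ^+ j * i') (j + j').
Proof. by rewrite /elt aXD bXD -!mulgA; congr (_ * _)%g; rewrite !mulgA bX_aX. Qed.

Lemma elt00 : elt 0 0 = 1%g.
Proof. by rewrite /elt !expg0 mulg1. Qed.

Lemma eltX i j m : (elt i j ^+ m)%g = elt (i * geo (nu ^+ j) m) (j *+ m).
Proof.
elim: m => [|m IH].
  by rewrite expg0 mulr0n /geo big_ord0 mulr0 elt00.
by rewrite expgS IH eltM geoS mulrS; congr elt; ring.
Qed.

Lemma eltJ h i j : (elt i j ^ (elt h 0)^-1)%g = elt (i + h * (1 - nu ^+ j)) j.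
Proof.
have e : (elt h 0 * elt i j = elt (i + h * (1 - nu ^+ j)) j * elt h 0)%g.
  by rewrite !eltM; congr elt; rewrite ?expr0; ring.
by rewrite conjgE invgK [LHS]mulgA e mulgK.
Qed.

Lemma commute_elt i j i' j' : commute (elt i j) (elt i' j') <->
  (nu ^+ j - 1) * i' = (nu ^+ j' - 1) * i.
Proof.
have subE (x y z w : R) : x - y = z - w -> x = y <-> z = w.
  move=> e; split=> xy; apply/eqP; rewrite -subr_eq0.
    by rewrite -e xy subrr.
  by rewrite e xy subrr.
have cross : (i + nu ^+ j * i' = i' + nu ^+ j' * i) <->
    (nu ^+ j - 1) * i' = (nu ^+ j' - 1) * i by apply: subE; ring.
rewrite /commute !eltM -cross; split=> [/elt_inj[]//|->].
by congr elt; exact: addrC.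
Qed.

Lemma sum_elt (V : nmodType) (g : G -> V) :
  \sum_x g x = \sum_i \sum_j g (elt i j).
Proof. by rewrite (reindex _ (onW_bij _ bij_ab)) /= pair_bigA. Qed.

(** These are the j for which [elt i j] lies in A = <a, b^q>. *)
Definition qmul : {set 'Z_N} := [set j : 'Z_N | (q %| j)%N].

Lemma nuX_qmul j : j \in qmul -> nu ^+ j = 1.
Proof. by rewrite inE => /(nuX_dvd nuq). Qed.

Lemma qmulB j j' : j \in qmul -> j' \in qmul -> j - j' \in qmul.
Proof.
rewrite !inE => qj qj'; rewrite -(dvdn_addl _ qj') -dvdqD.
by rewrite subrK.
Qed.

Lemma card_qmul : #|qmul| = l.
Proof.
have f_inj : injective (fun c : 'I_l => (q * c)%:R : 'Z_N).
  move=> c d /(congr1 (@nat_of_ord _)); rewrite !val_Zp_nat ?N_gt1 // -!muln_modr.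
  move/eqP; rewrite eqn_pmul2l ?prime_gt0 // !modn_small // => /eqP; exact: val_inj.
rewrite -[RHS]card_ord -(card_imset _ f_inj); apply: eq_card => j.
rewrite inE; apply/idP/imsetP => [/dvdnP[c jc]|[c _ ->]].
  have cl : (c < l)%N.
    rewrite -(ltn_pmul2l (prime_gt0 q_prime)) mulnC -jc.
    by rewrite -[X in (_ < X)%N](Zp_cast N_gt1).
  exists (Ordinal cl) => //; rewrite (_ : (q * Ordinal cl)%N = j) ?natr_Zp //=.
  by rewrite jc mulnC.
by rewrite val_Zp_nat ?N_gt1 // dvdq_mod dvdn_mulr.
Qed.

Lemma nuX_inj c : injective (fun x : R => nu ^+ c * x).
Proof.
apply: (root_of_unity_inj (prime_gt0 q_prime)).
by rewrite -exprM mulnC exprM nuq expr1n.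
Qed.

Lemma nuX_eq c (x y : R) : (nu ^+ c * x == nu ^+ c * y) = (x == y).
Proof. exact: inj_eq (@nuX_inj c) x y. Qed.

Lemma nu_stable_annihilator (c x : R) :
  (nu * x \in annihilator c) = (x \in annihilator c).
Proof.
rewrite !inE mulrCA.
by have := nuX_eq 1 (c * x) 0; rewrite mulr0.
Qed.

Lemma nuX_stable (P : {set R}) : (forall x, (nu * x \in P) = (x \in P)) ->
  forall c x, (nu ^+ c * x \in P) = (x \in P).
Proof.
move=> nuP c; elim: c => [|c IH] x; first by rewrite mul1r.
by rewrite exprS -mulrA nuP IH.
Qed.

(** * Sums of traces over homomorphic images of groups *)

Section Traces.
Variables (F : numClosedFieldType) (d : nat) (pi : G -> G -> 'M[F]_d).
Hypothesis pi_rep : double_rep pi.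
Implicit Types (u : G) (al : R) (m : nat) (P : {set R}) (Q : {set 'Z_N}).

(** For m = q M, the m-th power of [elt i j] is [elt (al * i) (j *+ m)] with al = m on A and al = M
    S off A. *)
Definition trace_sum u al m P Q : F :=
  \sum_(j in Q) \sum_(i in P) \tr (pi u (elt (al * i) (j *+ m))).

Definition mean_mx u al m P Q : 'M[F]_d :=
  (#|P| * #|Q|)%:R^-1 *:
    \sum_(j in Q) \sum_(i in P) pi u (elt (al * i) (j *+ m)).

Definition commutes_with u al m P Q :=
  (forall i, i \in P -> commute u (elt (al * i) 0)) /\
  (forall j, j \in Q -> commute u (elt 0 (j *+ m))).

Lemma card_set_neq0 (T : finType) (A : {set T}) x : x \in A -> #|A|%:R != 0 :> F.
Proof. by move=> xA; rewrite pnatr_eq0 -lt0n; apply/card_gt0P; exists x. Qed.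

Lemma trace_sumE u al m P Q : 0 \in P -> 0 \in Q ->
  trace_sum u al m P Q = (#|P| * #|Q|)%:R * \tr (mean_mx u al m P Q).
Proof.
move=> P0 Q0; rewrite /mean_mx mxtraceZ mulrA mulfV ?mul1r.
  by rewrite !raddf_sum; apply: eq_bigr => j _; rewrite !raddf_sum.
by rewrite natrM mulf_neq0 // (card_set_neq0 P0, card_set_neq0 Q0).
Qed.

(** The mean is the product of a mean over powers of a and one over powers of b. Both are
    idempotent, as group averages, and they commute because conjugation by b multiplies exponents of
    a by nu, which preserves P. *)
Lemma mean_mx_idem u al m P Q : commutes_with u al m P Q ->
    0 \in P -> 0 \in Q ->
    (forall x y, x \in P -> y \in P -> x - y \in P) ->
    (forall x y, x \in Q -> y \in Q -> x - y \in Q) ->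
    (forall x, (nu * x \in P) = (x \in P)) ->
  mean_mx u al m P Q * mean_mx u al m P Q = mean_mx u al m P Q.
Proof.
move=> [uP uQ] P0 Q0 PB QB nuP.
pose Ea := #|P|%:R^-1 *: \sum_(i in P) pi u (elt (al * i) 0).
pose Eb := #|Q|%:R^-1 *: \sum_(j in Q) pi u (elt 0 (j *+ m)).
have EaEb : Ea * Eb = mean_mx u al m P Q.
  rewrite /Ea /Eb -mxscalerAl -mxscalerAr scalerA -invfM -natrM /mean_mx.
  congr (_ *: _); rewrite mulr_sumr; apply: eq_bigr => j jQ.
  rewrite mulr_suml; apply: eq_bigr => i iP.
  by rewrite (double_repM pi_rep _ (uP _ iP)) eltM mulr0 addr0 add0r.
have EbEa : Eb * Ea = mean_mx u al m P Q.
  rewrite /Ea /Eb -mxscalerAl -mxscalerAr scalerA -invfM -natrM mulnC /mean_mx.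
  congr (_ *: _); rewrite mulr_suml; apply: eq_bigr => j jQ.
  rewrite mulr_sumr [RHS](reindex_inj (@nuX_inj (j *+ m)%R)) /=.
  apply: eq_big => [i|i iP]; first by rewrite nuX_stable.
  by rewrite (double_repM pi_rep _ (uQ _ jQ)) eltM add0r addr0 mulrCA.
have EaEa : Ea * Ea = Ea.
  apply: (idem_mean (s := fun i => pi u (elt (al * i) 0))) => //.
    exact: card_set_neq0 P0.
  move=> x y xP yP /=; rewrite (double_repM pi_rep _ (uP _ xP)) eltM.
  by rewrite addr0 mulrDr expr0 mul1r.
have EbEb : Eb * Eb = Eb.
  apply: (idem_mean (s := fun j => pi u (elt 0 (j *+ m)))) => //.
    exact: card_set_neq0 Q0.
  move=> x y xQ yQ /=; rewrite (double_repM pi_rep _ (uQ _ xQ)) eltM.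
  by rewrite mulr0 addr0 mulrnDl.
transitivity (Ea * Eb * (Eb * Ea)); first by rewrite EaEb EbEa.
by rewrite -mulrA (mulrA Eb) EbEb EbEa -EaEb mulrA EaEa.
Qed.

Lemma trace_sum_nat u al m P Q : commutes_with u al m P Q ->
    0 \in P -> 0 \in Q ->
    (forall x y, x \in P -> y \in P -> x - y \in P) ->
    (forall x y, x \in Q -> y \in Q -> x - y \in Q) ->
    (forall x, (nu * x \in P) = (x \in P)) ->
  exists c : nat, trace_sum u al m P Q = (#|P| * #|Q|)%:R * c%:R.
Proof.
move=> uPQ P0 Q0 PB QB nuP; exists (\rank (mean_mx u al m P Q)).
by rewrite trace_sumE // (mxtrace_idem (mean_mx_idem uPQ P0 Q0 PB QB nuP)).
Qed.

(** Conjugation by powers of a fixes u and shifts x by multiples of nu^j - 1, which generates the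
    same ideal as nu - 1. *)
Lemma tr_elt_conj u (x y : R) (j : 'Z_N) : (forall h, commute u (elt h 0)) ->
    ~~ (q %| j)%N -> (exists z, x - y = (nu - 1) * z) ->
  \tr (pi u (elt x j)) = \tr (pi u (elt y j)).
Proof.
move=> uh qj [z xyz]; have [z' nuE] := sub1_nuX q_prime nuq qj.
pose g := z' * z; have -> : elt y j = (elt x j ^ (elt g 0)^-1)%g.
  rewrite eltJ; congr elt; transitivity (x - (x - y)); first by ring.
  by rewrite xyz nuE /g; ring.
rewrite -[in LHS](tr_double_repJ pi_rep u _ (elt g 0)^-1%g).
congr (\tr (pi _ _)); apply/conjg_fixP/commgP.
exact/commuteV.
Qed.

Lemma cardT : #|[set: R]| = k.
Proof. by rewrite cardsT card_ord Zp_cast. Qed.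

Lemma card_NT : #|[set: 'Z_N]| = N.
Proof. by rewrite cardsT card_ord Zp_cast ?N_gt1. Qed.

Lemma zero_in_qmul : 0 \in qmul.
Proof. by rewrite inE dvdn0. Qed.

(** Each sum is a priori only a multiple of k l. The extra factor q comes from
    [trace_idem_sub_divisible], with X the action of b; its hypothesis on traces is
    [tr_elt_conj]. *)
Lemma trace_sum_sub_divisible u al al' m : (forall x, commute u x) ->
    (exists z, al - al' = (nu - 1) * z) ->
  exists2 z : F, is_int z &
    trace_sum u al m [set: R] qmul - trace_sum u al' m [set: R] qmul
    = (k * N)%:R * z.
Proof.
move=> uc [z alz].
have idem c : mean_mx u c m [set: R] qmul * mean_mx u c m [set: R] qmul =
    mean_mx u c m [set: R] qmul.
  apply: mean_mx_idem zero_in_qmul _ qmulB _ => // *; by rewrite !inE.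
have uJ x : (u ^ x = u)%g by exact/conjg_fixP/commgP.
pose X := group_mx pi b.
have Xpi x : X * pi u x = pi u (b * x)%g by rewrite (group_mx_pi pi_rep) uJ.
have bE : b = elt 0 1 by rewrite /elt expg0 mul1g expg1.
have Xr r : X ^+ r = group_mx pi (elt 0 r%:R).
  rewrite (group_mxX pi_rep) /elt expg0 mul1g val_Zp_nat ?N_gt1 //.
  by rewrite expg_mod.
have XN : X ^+ N = 1 by rewrite (group_mxX pi_rep) bN (group_mx1 pi_rep).
have XE c : X * mean_mx u c m [set: R] qmul = mean_mx u c m [set: R] qmul * X.
  rewrite /mean_mx -mxscalerAl -mxscalerAr; congr (_ *: _).
  rewrite mulr_sumr mulr_suml; apply: eq_bigr => j _.
  rewrite mulr_sumr mulr_suml [RHS](reindex_inj (@nuX_inj 1)) /=.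
  apply: eq_big => i; rewrite ?inE // => _.
  rewrite Xpi (pi_group_mx pi_rep) bE !eltM; congr (pi u (elt _ _)).
    by rewrite -[1%R]/(1%:R) val_Zp_nat ?N_gt1 // modn_small ?N_gt1 //; ring.
  exact: addrC.
have trX r : ~~ (q %| r)%N -> \tr (X ^+ r * mean_mx u al m [set: R] qmul) =
    \tr (X ^+ r * mean_mx u al' m [set: R] qmul).
  move=> qr; rewrite /mean_mx -!mxscalerAr !mxtraceZ; congr (_ * _).
  rewrite !mulr_sumr !raddf_sum; apply: eq_bigr => j; rewrite inE => qj.
  rewrite /= !mulr_sumr !raddf_sum; apply: eq_bigr => i _ /=.
  rewrite Xr !(group_mx_pi pi_rep) !uJ !eltM !add0r; apply: tr_elt_conj => //.
    rewrite dvdqD dvdn_addl ?val_Zp_nat ?N_gt1 ?dvdq_mod //.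
    by rewrite dvdq_mulrn dvdn_mulr.
  exists (nu ^+ (r%:R : 'Z_N) * z * i).
  by rewrite -mulrBr -mulrBl alz; ring.
have [y y_int yE] := trace_idem_sub_divisible (prime_gt0 q_prime) l_gt0 XN
  (idem _) (idem _) (XE _) (XE _) trX.
exists y => //; rewrite !trace_sumE ?inE ?dvdn0 // cardT card_qmul -mulrBr yE.
by rewrite !natrM; ring.
Qed.

(** Adding multiples of c moves any exponent into [qmul] without changing its product by m, so both
    index sets have the same image under multiplication by m. *)
Lemma trace_sum_full u al m (c : 'Z_N) : c *+ m = 0 :> 'Z_N -> ~~ (q %| c)%N ->
  trace_sum u al m [set: R] [set: 'Z_N] = q%:R * trace_sum u al m [set: R] qmul.
Proof.
move=> cm qc.
pose g j := \sum_(i in [set: R]) \tr (pi u (elt (al * i) j)).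
have gE Q : trace_sum u al m [set: R] Q = \sum_(j in Q) g (j *+ m) by [].
have mD : {morph (fun j : 'Z_N => j *+ m) : x y / x + y}.
  by move=> x y; rewrite mulrnDl.
have l0 : l%:R != 0 :> F by rewrite pnatr_eq0 -lt0n.
have gE' : trace_sum u al m [set: R] [set: 'Z_N] *+ #|qmul| =
    trace_sum u al m [set: R] qmul *+ #|[set: 'Z_N]|.
  rewrite !gE; apply: (same_image_sum (f1 := fun j => j *+ m)
    (f2 := fun j => j *+ m) g mD mD _ qmulB) => [x y|j _|j jQ].
  - by rewrite !inE.
  - have [c0|c0] := posnP (c : nat); first by rewrite c0 dvdn0 in qc.
    have /eqP cq : coprime c q by rewrite coprime_sym prime_coprime.
    have [v w vw _] := egcdnP q c0; rewrite cq in vw.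
    (* As v c = 1 modulo q, the new exponent is j + (q - 1) j = 0 modulo q. *)
    exists (j + c *+ (v * (q.-1 * j))); last first.
      by rewrite mulrnDl mulrnAC cm mul0rn addr0.
    rewrite inE dvdqD val_Zp_mulrn /dvdn -modnDmr modn_dvdm ?dvdn_mulr // modnDmr.
    rewrite -/(dvdn _ _) mulnA (mulnC c) vw mulnDl mul1n addnCA -mulSn.
    by rewrite prednK ?prime_gt0 // -[X in (X + _)%N]mulnA mulnCA -mulnDr dvdn_mulr.
  - by exists j; rewrite ?inE.
move: gE'; rewrite card_qmul card_NT => gE'.
apply: (mulfI l0); rewrite [LHS]mulr_natl gE' -[LHS]mulr_natl natrM; ring.
Qed.

(** * Orders of centralizers *)

Lemma commute_inv_elt s (t : 'Z_N) i (j : 'Z_N) :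
    (nu ^+ t - 1) * i = (nu ^+ j - 1) * s :> R ->
  commute (elt s t)^-1%g (elt i j).
Proof. by move=> e; apply/commute_sym/commuteV/commute_sym/commute_elt. Qed.

Lemma card_cent_elt (s : R) (t : 'Z_N) : #|'C[(elt s t)^-1]%g| =
  (\sum_(j : 'Z_N) #|[set i : R | ((nu ^+ t - 1) * i == (nu ^+ j - 1) * s)%R]|)%N.
Proof.
have -> : #|'C[(elt s t)^-1]%g| = (\sum_x (x \in 'C[(elt s t)^-1]%g))%N.
  by rewrite -sum1_card big_mkcond; apply: eq_bigr => x _; case: (x \in _).
rewrite sum_elt exchange_big; apply: eq_bigr => j _.
rewrite -sum1_card [RHS]big_mkcond /=; apply: eq_bigr => i _; rewrite [in RHS]inE.
have -> : (elt i j \in 'C[(elt s t)^-1]%g) =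
    ((nu ^+ t - 1) * i == (nu ^+ j - 1) * s).
  apply/cent1P/eqP => [e|e]; last exact/commute_sym/commute_inv_elt.
  apply/commute_elt/commute_sym; rewrite -[elt s t]invgK.
  exact/commuteV.
by case: eqP.
Qed.

Lemma card_cent_central (s : R) (t : 'Z_N) : (q %| t)%N -> (nu - 1) * s = 0 ->
  #|'C[(elt s t)^-1]%g| = (k * N)%N.
Proof.
move=> qt nus; rewrite card_cent_elt (eq_bigr (fun=> k)).
  by rewrite sum_nat_const card_ord Zp_cast ?N_gt1 // mulnC.
move=> j _; rewrite -[RHS]cardT; congr #|pred_of_set _|; apply/setP=> i.
have [y ->] := nuX_sub1 nu j.
by rewrite !inE (nuX_dvd nuq qt) subrr mul0r mulrAC nus mul0r eqxx.
Qed.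

Lemma card_cent_inner (s : R) (t : 'Z_N) : (q %| t)%N -> (nu - 1) * s != 0 ->
  #|'C[(elt s t)^-1]%g| = (k * l)%N.
Proof.
move=> qt nus; transitivity (\sum_(j in qmul) k)%N; last first.
  by rewrite sum_nat_const card_qmul mulnC.
rewrite card_cent_elt.
rewrite [RHS]big_mkcond; apply: eq_bigr => j _; case: ifPn => [jQ|].
  rewrite -[RHS]cardT; congr #|pred_of_set _|; apply/setP=> i.
  by rewrite !inE (nuX_dvd nuq qt) (nuX_qmul jQ) !subrr !mul0r eqxx.
rewrite inE => /(sub1_nuX q_prime nuq)[y yE].
apply: eq_card0 => i; rewrite inE (nuX_dvd nuq qt) subrr mul0r eq_sym.
apply: contraNF nus => /eqP nus; rewrite yE; apply/eqP.
by rewrite mulrAC nus mul0r.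
Qed.

(** Since nu^t - 1 and nu - 1 generate the same ideal, for each j the equation in i is solvable and
    its solutions form a coset of the annihilator of nu - 1. *)
Lemma card_cent_outer (s : R) (t : 'Z_N) : ~~ (q %| t)%N ->
  #|'C[(elt s t)^-1]%g| = (#|annihilator (nu - 1)%R| * N)%N.
Proof.
move=> /(sub1_nuX q_prime nuq)[z zE].
rewrite card_cent_elt (eq_bigr (fun=> #|annihilator (nu - 1)%R|)).
  by rewrite sum_nat_const card_ord Zp_cast ?N_gt1 // mulnC.
move=> j _; have [y yE] := nuX_sub1 nu j; have [x xE] := nuX_sub1 nu t.
rewrite -[RHS](card_imset _ (addrI (z * y * s))); apply: eq_card => i.
have jtE : (nu ^+ j - 1) * s = (nu ^+ t - 1) * (z * y * s).
  by rewrite yE zE; ring.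
rewrite inE jtE; apply/eqP/imsetP => [e|[i' + ->]].
  exists (i - z * y * s); last by rewrite addrC subrK.
  by rewrite inE zE mulrAC mulrBr e subrr mul0r.
by rewrite inE => /eqP i'0; rewrite mulrDr xE [_ * i']mulrAC i'0 mul0r addr0.
Qed.

(** Writing u as the inverse of [elt s t] makes x u^-1 the product of x and [elt s t]. *)
Lemma indicator_elt (s : R) (t : 'Z_N) m : indicator_part pi m (elt s t)^-1%g =
  \sum_(j : 'Z_N) \sum_(i | ((i + nu ^+ j * s) * geo (nu ^+ j * nu ^+ t) m ==
                    i * geo (nu ^+ j) m) && (t *+ m == 0))
    \tr (pi (elt s t)^-1%g (elt (i * geo (nu ^+ j) m) (j *+ m))).
Proof.
rewrite /indicator_part big_mkcond sum_elt exchange_big.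
apply: eq_bigr => j _; rewrite [RHS]big_mkcond; apply: eq_bigr => i _.
rewrite invgK eltM !eltX elt_eq nuXD mulrnDl [_ + t *+ m]addrC.
by rewrite -[X in _ + _ == X]add0r (inj_eq (addIr _)).
Qed.

(** Both assertions are packed into one predicate stable under sums, so that they can be checked
    class by class. *)
Definition int_nneg (x : F) : Prop :=
  is_int x /\ (~~ (q %| l)%N -> q <> 2%N \/ ~~ (8 %| k)%N -> 0 <= x).

Lemma int_nneg_nat c : int_nneg c%:R.
Proof. by split=> [|_ _]; [exact: is_int_nat|exact: ler0n]. Qed.

Lemma int_nnegD x y : int_nneg x -> int_nneg y -> int_nneg (x + y).
Proof.
move=> [xi x0] [yi y0]; split=> [|ql q8]; first exact: is_intD.
by rewrite addr_ge0 ?x0 ?y0.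
Qed.

Lemma int_nneg_div x c y :
  (0 < c)%N -> x = c%:R * y -> int_nneg y -> int_nneg (x / c%:R).
Proof. by move=> c0 ->; rewrite mulrAC mulfV ?mul1r // pnatr_eq0 -lt0n. Qed.

Lemma trace_sum_full_nat u al m : (forall i, commute u (elt (al * i) 0)) ->
    (forall j, commute u (elt 0 (j *+ m))) ->
  exists c : nat, trace_sum u al m [set: R] [set: 'Z_N] = (k * N)%:R * c%:R.
Proof.
move=> ui uj.
have [||||||c ->] := @trace_sum_nat u al m [set: R] [set: 'Z_N].
- by split=> *.
- exact: in_setT.
- exact: in_setT.
- by move=> *; exact: in_setT.
- by move=> *; exact: in_setT.
- by move=> x; rewrite !in_setT.
by exists c; rewrite cardT card_NT.
Qed.

Lemma trace_sum_qmul_nat u al m : (forall i, commute u (elt (al * i) 0)) ->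
    (forall j, j \in qmul -> commute u (elt 0 (j *+ m))) ->
  exists c : nat, trace_sum u al m [set: R] qmul = (k * l)%:R * c%:R.
Proof.
move=> ui uj.
have [||||c ->] := @trace_sum_nat u al m [set: R] qmul _ _ zero_in_qmul _ qmulB.
- by split=> *; [exact: ui|exact: uj].
- exact: in_setT.
- by move=> *; exact: in_setT.
- by move=> x; rewrite !in_setT.
by exists c; rewrite cardT card_qmul.
Qed.

(** * Classes contained in A, and exponents m prime to q *)

Lemma indicator_inner (s : R) (t : 'Z_N) m : (q %| t)%N ->
  indicator_part pi m (elt s t)^-1%g =
  \sum_(j : 'Z_N) if (s * geo (nu ^+ j) m == 0) && (t *+ m == 0) then
    \sum_(i in [set: R])
      \tr (pi (elt s t)^-1%g (elt (geo (nu ^+ j) m * i) (j *+ m))) else 0.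
Proof.
move=> qt; rewrite indicator_elt; apply: eq_bigr => j _.
rewrite (nuX_dvd nuq qt) mulr1.
(* As nu^t = 1, the terms in i cancel and the condition depends on j only. *)
have cond (i : R) : ((i + nu ^+ j * s) * geo (nu ^+ j) m == i * geo (nu ^+ j) m) =
    (s * geo (nu ^+ j) m == 0).
  rewrite mulrDl [i * _ + _]addrC -[X in _ + _ == X]add0r (inj_eq (addIr _)).
  by rewrite -mulrA -{1}(mulr0 (nu ^+ j)) nuX_eq.
under eq_bigl do rewrite cond.
case: (_ && _); last by rewrite big_pred0.
by apply: eq_big => [i|i _]; rewrite ?inE // [i * _]mulrC.
Qed.

Lemma geo_qmul j m : j \in qmul -> geo (nu ^+ j) m = m%:R.
Proof. by move=> jQ; rewrite (nuX_qmul jQ) geo1. Qed.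

(** Here t m = 0 forces q to divide t. If u is central, [tr_elt_conj] replaces every geometric sum
    by m, which leaves a sum over Z_k x Z_N; otherwise only the j in [qmul] contribute, and |C(u)| =
    k l. *)
Lemma int_nneg_coprime (s : R) (t : 'Z_N) m : ~~ (q %| m)%N ->
  int_nneg (indicator_part pi m (elt s t)^-1%g / #|'C[(elt s t)^-1]%g|%:R).
Proof.
move=> qm; have [qt|qt] := boolP (q %| t)%N; last first.
  suff tm : t *+ m != 0.
    rewrite indicator_elt big1 ?mul0r; first exact: (int_nneg_nat 0).
    by move=> j _; rewrite big_pred0 // => i; rewrite (negPf tm) andbF.
  apply/eqP => /(congr1 (@nat_of_ord _)) tm.
  have := dvdq_mulrn t m; rewrite tm dvdn0 Euclid_dvdM //.
  by rewrite (negPf qt) (negPf qm).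
rewrite indicator_inner //; set u := (elt s t)^-1%g.
have [nus|nus] := eqVneq ((nu - 1) * s) 0.
  have uc i j : commute u (elt i j).
    apply: commute_inv_elt; rewrite (nuX_dvd nuq qt) subrr mul0r.
    by have [y ->] := nuX_sub1 nu j; rewrite mulrAC nus mul0r.
  rewrite card_cent_central // (eq_bigr (fun j : 'Z_N =>
    if (s * m%:R == 0) && (t *+ m == 0) then
      \sum_(i in [set: R]) \tr (pi u (elt (m%:R * i) (j *+ m))) else 0)).
    case: ((s * m%:R == 0) && (t *+ m == 0)); last first.
      by rewrite big1_eq mul0r; exact: (int_nneg_nat 0).
    have [c cE] := trace_sum_full_nat (al := m%:R) (m := m)
      (fun i => uc _ _) (fun j => uc _ _).
    apply: (int_nneg_div _ _ (int_nneg_nat c)).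
      by rewrite muln_gt0 (ltnW k_gt1) (ltnW N_gt1).
    by rewrite -cE; apply: eq_bigl => j; rewrite inE.
  move=> j _; have [y yE] := geo_nat (nu ^+ j) m; have [z zE] := nuX_sub1 nu j.
  have -> : s * geo (nu ^+ j) m = s * m%:R.
    rewrite yE zE mulrDr; transitivity (s * m%:R + (nu - 1) * s * (z * y)).
      by ring.
    by rewrite nus mul0r addr0.
  case: ifP => // _; apply: eq_bigr => i _.
  have [jQ|] := boolP (j \in qmul); first by rewrite geo_qmul.
  rewrite inE => qj; apply: tr_elt_conj => [h||]; first exact: uc.
    by rewrite dvdq_mulrn Euclid_dvdM // negb_or qj.
  by exists (z * y * i); rewrite yE zE; ring.
rewrite card_cent_inner // (bigID (mem qmul)) /= [X in _ + X]big1 ?addr0.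
  rewrite (eq_bigr (fun j : 'Z_N =>
    if (s * m%:R == 0) && (t *+ m == 0) then
      \sum_(i in [set: R]) \tr (pi u (elt (m%:R * i) (j *+ m))) else 0)).
    case: ((s * m%:R == 0) && (t *+ m == 0)); last first.
      by rewrite big1_eq mul0r; exact: (int_nneg_nat 0).
    have [||c cE] := @trace_sum_qmul_nat u m%:R m.
    - by move=> i; apply: commute_inv_elt; rewrite (nuX_dvd nuq qt) !subrr !mul0r.
    - move=> j jQ; apply: commute_inv_elt.
      by rewrite (nuX_dvd nuq qt) nuX_mulrn (nuX_qmul jQ) expr1n !subrr !mul0r.
    apply: (int_nneg_div _ _ (int_nneg_nat c)) => //.
    by rewrite muln_gt0 (ltnW k_gt1).
  by move=> j jQ; rewrite geo_qmul.
(* A contribution off [qmul] would give (nu^(j m) - 1) s = 0, hence (nu - 1) s = 0. *)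
move=> j; rewrite inE => qj; case: ifP => // /andP[/eqP sg _].
have : ~~ (q %| j * m)%N by rewrite Euclid_dvdM // negb_or qj.
move/(sub1_nuX q_prime nuq) => [y yE]; case/eqP: nus.
rewrite yE exprM subrX1 -/(geo _ _) -!mulrA [y * s]mulrC.
by rewrite [geo _ _ * _]mulrCA mulrA sg mul0r mulr0.
Qed.

Lemma indicator_inner_mul (s : R) (t : 'Z_N) M : (q %| t)%N ->
  let u := (elt s t)^-1%g in let m := (q * M)%N in
  indicator_part pi m u = if t *+ m == 0 then
    (if s * m%:R == 0 then trace_sum u m%:R m [set: R] qmul else 0) +
    (if s * (M%:R * S) == 0 then
       trace_sum u (M%:R * S) m [set: R] [set: 'Z_N] -
       trace_sum u (M%:R * S) m [set: R] qmul else 0) else 0.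
Proof.
move=> qt u m; rewrite indicator_inner // -/u.
case: (t *+ m == 0); last by rewrite big1 // => j _; rewrite andbF.
rewrite (bigID (mem qmul)) /=; congr (_ + _).
  rewrite (eq_bigr (fun j : 'Z_N => if s * m%:R == 0 then
    \sum_(i in [set: R]) \tr (pi u (elt (m%:R * i) (j *+ m))) else 0)).
    by case: (s * m%:R == 0); rewrite // big1_eq.
  by move=> j jQ; rewrite geo_qmul // andbT.
rewrite (eq_bigr (fun j : 'Z_N => if s * (M%:R * S) == 0 then
    \sum_(i in [set: R]) \tr (pi u (elt (M%:R * S * i) (j *+ m))) else 0)).
  case: (s * (M%:R * S) == 0); last by rewrite big1_eq.
  apply/eqP; rewrite -subr_eq opprK; apply/eqP.
  rewrite /trace_sum [in RHS](bigID (mem qmul)) /= addrC.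
  by congr (_ + _); apply: eq_bigl => j; rewrite !inE.
by move=> j; rewrite inE => qj; rewrite (geo_nuX q_prime nuq) // andbT.
Qed.

Lemma int_nneg_inner (s : R) (t : 'Z_N) M : (q %| t)%N ->
  int_nneg (indicator_part pi (q * M) (elt s t)^-1%g / #|'C[(elt s t)^-1]%g|%:R).
Proof.
move=> qt; rewrite indicator_inner_mul //=; set u := (elt s t)^-1%g.
set m := (q * M)%N.
have [tm|_] := eqVneq (t *+ m) 0; last by rewrite mul0r; exact: (int_nneg_nat 0).
have kl0 : (0 < k * l)%N by rewrite muln_gt0 (ltnW k_gt1).
have kN0 : (0 < k * N)%N by rewrite muln_gt0 (ltnW k_gt1) (ltnW N_gt1).
(* The exponent l is killed by m = q M and lies outside [qmul]. *)
have full al : ~~ (q %| l)%N -> trace_sum u al m [set: R] [set: 'Z_N] =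
    q%:R * trace_sum u al m [set: R] qmul.
  move=> ql; apply: (trace_sum_full _ _ (c := l%:R)).
    by rewrite -mulrnA mulnA [(l * q)%N]mulnC mulrnA pchar_Zp ?N_gt1 // mul0rn.
  by rewrite val_Zp_nat ?N_gt1 // dvdq_mod.
have q1 : 0 <= q%:R - 1 :> F.
  by rewrite subr_ge0 ler1n prime_gt0.
have [nus|nus] := eqVneq ((nu - 1) * s) 0.
  have uc i j : commute u (elt i j).
    apply: commute_inv_elt; rewrite (nuX_dvd nuq qt) subrr mul0r.
    by have [y ->] := nuX_sub1 nu j; rewrite mulrAC nus mul0r.
  have ucx x : commute u x by have [i [j ->]] := eltP x.
  have [y yE] := geo_nat nu q.
  (* S equals q modulo nu - 1, which kills s, so the two conditions coincide. *)
  have -> : s * (M%:R * S) = s * m%:R.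
    rewrite yE natrM; transitivity (s * (q%:R * M%:R) + (nu - 1) * s * (M%:R * y)).
      by ring.
    by rewrite nus mul0r addr0.
  case: (s * m%:R == 0); last by rewrite addr0 mul0r; exact: (int_nneg_nat 0).
  have [|z z_int zE] := @trace_sum_sub_divisible u m%:R (M%:R * S) m ucx.
    by exists (- (M%:R * y)); rewrite yE natrM; ring.
  have [c cE] := trace_sum_full_nat (al := M%:R * S) (m := m)
    (fun i => uc _ _) (fun j => uc _ _).
  have [c1 c1E] := trace_sum_qmul_nat (al := m%:R) (m := m)
    (fun i => uc _ _) (fun j _ => uc _ _).
  have [c3 c3E] := trace_sum_qmul_nat (al := M%:R * S) (m := m)
    (fun i => uc _ _) (fun j _ => uc _ _).
  rewrite card_cent_central //.
  (* The full sum is k N c, and the difference of the two sums over [qmul] is k N z. *)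
  apply: (int_nneg_div kN0 (y := z + c%:R)).
    by rewrite mulrDr -zE -cE; ring.
  split=> [|ql _]; first exact: is_intD z_int (is_int_nat _ _).
  rewrite -(pmulr_rge0 (x := (k * N)%:R)) ?ltr0n // mulrDr -zE -cE.
  rewrite (full _ ql) c1E c3E.
  rewrite [leRHS](_ : _ = (k * l)%:R * (c1%:R + (q%:R - 1) * c3%:R)); last by ring.
  by rewrite mulr_ge0 ?addr_ge0 ?ler0n // mulr_ge0 ?ler0n.
have ui i : commute u (elt i 0).
  by apply: commute_inv_elt; rewrite (nuX_dvd nuq qt) !subrr !mul0r.
have uj (j : 'Z_N) : commute u (elt 0 (j *+ m)).
  apply: commute_inv_elt; rewrite nuX_mulrn mulr0 -exprM (nuX_dvd nuq).
    by rewrite subrr mul0r.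
  by rewrite mulnCA dvdn_mulr.
have [c1 c1E] := trace_sum_qmul_nat (al := m%:R) (fun i => ui _) (fun j _ => uj j).
have [c2 c2E] := trace_sum_full_nat (al := M%:R * S) (fun i => ui _) uj.
have [c3 c3E] := trace_sum_qmul_nat (al := M%:R * S)
  (fun i => ui _) (fun j _ => uj j).
rewrite card_cent_inner // mulrDl; apply: int_nnegD.
  case: (s * m%:R == 0); last by rewrite mul0r; exact: (int_nneg_nat 0).
  by rewrite c1E; apply: (int_nneg_div kl0 (erefl _)); exact: int_nneg_nat.
case: (s * (M%:R * S) == 0); last by rewrite mul0r; exact: (int_nneg_nat 0).
apply: (int_nneg_div kl0 (y := q%:R * c2%:R - c3%:R)).
  by rewrite c2E c3E !natrM; ring.
split=> [|ql _]; first by rewrite -natrM; apply: is_intB; exact: is_int_nat.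
rewrite -(pmulr_rge0 (x := (k * l)%:R)) ?ltr0n //.
rewrite [leRHS](_ : _ = (k * N)%:R * c2%:R - (k * l)%:R * c3%:R); last first.
  by rewrite !natrM; ring.
rewrite -c2E (full _ ql) c3E [leRHS](_ : _ = (k * l)%:R * ((q%:R - 1) * c3%:R)).
  by rewrite !mulr_ge0 ?ler0n.
by ring.
Qed.

(** * Classes outside A *)

Lemma sum_shift_qmul (t : 'Z_N) (h : 'Z_N -> F) : ~~ (q %| t)%N ->
  \sum_(j | (j \notin qmul) && (j + t \in qmul)) h j =
  \sum_(j in qmul) h (j - t).
Proof.
move=> qt; rewrite (reindex_inj (addIr (- t))) /=; apply: eq_bigl => j.
rewrite subrK; apply: andb_idl => jQ; apply: contra qt => jtQ.
by have := qmulB jQ jtQ; rewrite opprB addrC subrK inE.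
Qed.

(* The first term comes from the [x] in [A = <a, b^q>], the second one from the
   [x] such that [x u^-1] is in [A], and the last one from the other [x]. *)
Lemma indicator_outer (s : R) (t : 'Z_N) M : ~~ (q %| t)%N ->
  let u := (elt s t)^-1%g in let m := (q * M)%N in let c := M%:R * S in
  t *+ m = 0 -> indicator_part pi m u =
    trace_sum u m%:R m [set i | i * m%:R == (i + s) * c] qmul +
    trace_sum u m%:R m [set i | i * m%:R == (i - s) * c] qmul +
    (if s * c == 0 then (q%:R - 2%:R) * trace_sum u c m [set: R] qmul else 0).
Proof.
move=> qt u m c tm; rewrite indicator_elt tm eqxx -/u.
have nuc j : nu ^+ j * c = c by rewrite /c mulrCA (nuX_geo nuq).
have geo_out (j : 'Z_N) : ~~ (q %| j)%N -> geo (nu ^+ j) m = c.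
  by move=> qj; rewrite (geo_nuX q_prime nuq).
rewrite (bigID (mem qmul)) /= -addrA; congr (_ + _).
  apply: eq_bigr => j jQ; apply: eq_big => [i|i _]; last first.
    by rewrite geo_qmul // [i * _]mulrC.
  rewrite inE andbT geo_qmul // -nuXD geo_out; last first.
    by rewrite dvdqD; move: jQ; rewrite inE => /dvdn_addr ->.
  by rewrite (nuX_qmul jQ) mul1r eq_sym.
rewrite (bigID (fun j => j + t \in qmul)) /=; congr (_ + _).
  rewrite (sum_shift_qmul (fun j => \sum_(i | _) _)) //; apply: eq_bigr => j jQ.
  have qjt : ~~ (q %| (j - t)%R)%N.
    apply: contra qt => qjt; have jtQ : j - t \in qmul by rewrite inE.
    by have := qmulB jQ jtQ; rewrite opprB addrC subrK inE.
  have jE : j - t + t = j by rewrite subrK.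
  have jm : (j - t) *+ m = j *+ m by rewrite mulrnBl tm subr0.
  move: (j - t) qjt jE jm => j' qj' jE jm.
  (* The new variable is the exponent of a in x u^-1, which lies in A. *)
  rewrite (reindex_inj (addIr (- (nu ^+ j' * s)))) /=.
  have cond (i : R) : ((i - nu ^+ j' * s + nu ^+ j' * s) *
      geo (nu ^+ j' * nu ^+ t) m == (i - nu ^+ j' * s) * geo (nu ^+ j') m) && true =
      (i * m%:R == (i - s) * c).
    rewrite andbT subrK -nuXD jE (geo_qmul _ jQ) (geo_out j') // [in LHS]mulrBl.
    by rewrite mulrAC nuc [in RHS]mulrBl [s * c]mulrC.
  apply: eq_big => [i|i]; first by rewrite inE cond.
  rewrite cond jm => /eqP ci; congr (\tr (pi u (elt _ _))).
  rewrite geo_out // mulrBl mulrAC nuc [RHS]mulrC ci mulrBl.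
  by rewrite [s * c]mulrC.
transitivity (\sum_(j : 'Z_N | (j \notin qmul) && (j + t \notin qmul))
    if s * c == 0 then \sum_(i in [set: R]) \tr (pi u (elt (c * i) (j *+ m)))
    else 0).
  apply: eq_bigr => j /andP[]; rewrite inE => qj jtQ.
  have cond (i : R) : ((i + nu ^+ j * s) * geo (nu ^+ j * nu ^+ t) m ==
      i * geo (nu ^+ j) m) && true = (s * c == 0).
    rewrite andbT -nuXD !geo_out //; last by rewrite inE in jtQ.
    rewrite mulrDl [i * _ + _]addrC -[X in _ + _ == X]add0r (inj_eq (addIr _)).
    by rewrite mulrAC nuc mulrC.
  under eq_bigl do rewrite cond.
  case: (s * c == 0); last by rewrite big_pred0.
  by apply: eq_big => [i|i _]; rewrite ?inE // geo_out // [i * _]mulrC.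
case: (s * c == 0); last by rewrite big1_eq.
pose h (j : 'Z_N) := \sum_(i in [set: R]) \tr (pi u (elt (c * i) (j *+ m))).
have shift : \sum_(j | (j \notin qmul) && (j + t \in qmul)) h j =
    trace_sum u c m [set: R] qmul.
  rewrite sum_shift_qmul //; apply: eq_bigr => j _.
  by rewrite /h mulrnBl tm subr0.
have full : trace_sum u c m [set: R] [set: 'Z_N] = \sum_j h j.
  by apply: eq_bigl => j; rewrite inE.
(* As t is killed by m and lies off [qmul], the full sum is q times the one over [qmul]; removing
   [qmul] and its translate by - t leaves q - 2 copies. *)
rewrite mulrBl -(trace_sum_full _ _ tm qt) full.
rewrite [in RHS](bigID (mem qmul)) /= -/(trace_sum u c m [set: R] qmul).
rewrite [in RHS](bigID (fun j => j + t \in qmul)) /= shift /h.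
by ring.
Qed.

Lemma trace_sum_same_image u al al' m P1 P2 :
    (forall x y, x \in P1 -> y \in P1 -> x - y \in P1) ->
    (forall x y, x \in P2 -> y \in P2 -> x - y \in P2) ->
    (forall x, x \in P1 -> exists2 y, y \in P2 & al * x = al' * y) ->
    (forall y, y \in P2 -> exists2 x, x \in P1 & al' * y = al * x) ->
  trace_sum u al m P1 qmul *+ #|P2| = trace_sum u al' m P2 qmul *+ #|P1|.
Proof.
move=> P1B P2B im12 im21; rewrite /trace_sum exchange_big [in RHS]exchange_big /=.
exact: (same_image_sum (f1 := fun x => al * x) (f2 := fun y => al' * y)
  (fun x => \sum_(j in qmul) \tr (pi u (elt x (j *+ m))))
  (mulrDr al) (mulrDr al') P1B P2B im12 im21).
Qed.

(** The divisor is z0 N, with z0 the order of the annihilator of nu - 1. The sets [I1] and [I2] are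
    empty or cosets of the subgroup [K], and equal [K] if s c = 0. *)
Lemma int_nneg_outer (s : R) (t : 'Z_N) m : ~~ (q %| t)%N ->
  int_nneg (indicator_part pi m (elt s t)^-1%g / #|'C[(elt s t)^-1]%g|%:R).
Proof.
move=> qt; have [tm|tm] := eqVneq (t *+ m) 0; last first.
  rewrite indicator_elt big1 ?mul0r; first exact: (int_nneg_nat 0).
  by move=> j _; rewrite big_pred0 // => i; rewrite (negPf tm) andbF.
have /dvdnP[M mE] : (q %| m)%N.
  by have := dvdq_mulrn t m; rewrite tm dvdn0 Euclid_dvdM // (negPf qt).
rewrite mulnC in mE; rewrite {m}mE in tm *.
rewrite indicator_outer //; set u := (elt s t)^-1%g; set m := (q * M)%N.
set c := M%:R * S.
pose K := annihilator (M%:R * (q%:R - S)).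
have KE i : (i \in K) = (i * m%:R == i * c).
  by rewrite inE -[RHS]subr_eq0 /m /c natrM; congr (_ == 0); ring.
have Sq : exists y, q%:R - S = (nu - 1) * y.
  by have [y ->] := geo_nat nu q; exists (- y); ring.
have KB x y : x \in K -> y \in K -> x - y \in K.
  by rewrite !inE => /eqP xK /eqP yK; rewrite [X in X == _]mulrBr xK yK subrr.
have KZ x y : (nu - 1) * y = 0 -> (x + y \in K) = (x \in K).
  move=> yZ; apply: addr_closed_mem KB _; rewrite inE.
  have [z ->] := Sq; apply/eqP.
  transitivity (M%:R * z * ((nu - 1) * y)); first by ring.
  by rewrite yZ mulr0.
have nuK x : (nu * x \in K) = (x \in K) by exact: nu_stable_annihilator.
pose z0 := #|annihilator (nu - 1)|.
have z0_gt0 : (0 < z0)%N by apply/card_gt0P; exists 0; rewrite inE mulr0.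
pose wK := #|[set (nu - 1) * x | x in K]|.
have cardK : #|K| = (z0 * wK)%N.
  by apply: card_mul_fibers => x y /KZ ->.
have kE : k = (z0 * wK + #|~: K|)%N by rewrite -cardK cardsC card_ord Zp_cast.
have uz x : (nu - 1) * x = 0 -> commute u (elt x 0).
  move=> xZ; apply: commute_inv_elt; have [y ->] := nuX_sub1 nu t.
  by rewrite mulrAC xZ mul0r subrr mul0r.
have uj (j : 'Z_N) : commute u (elt 0 (j *+ m)).
  apply: commute_inv_elt; rewrite nuX_mulrn mulr0 -exprM (nuX_dvd nuq).
    by rewrite subrr mul0r.
  by rewrite mulnCA dvdn_mulr.
have cZ i : (nu - 1) * (c * i) = 0.
  transitivity (((nu - 1) * S) * (M%:R * i)); first by rewrite /c; ring.
  by rewrite mulrBl mul1r (nu_geo nuq) subrr mul0r.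
have sum_nat P : 0 \in P -> (forall x y, x \in P -> y \in P -> x - y \in P) ->
    (forall x, (nu * x \in P) = (x \in P)) ->
    (forall x, x \in P -> (nu - 1) * (m%:R * x) = 0) ->
  exists e : nat, trace_sum u m%:R m P qmul = (#|P| * l)%:R * e%:R.
  move=> P0 PB nuP PZ; rewrite -[l in (_ * l)%N]card_qmul.
  apply: trace_sum_nat P0 zero_in_qmul PB qmulB nuP.
  by split=> [i /PZ/uz|j _].
have Kmul i : i \in K -> m%:R * i = c * i.
  by rewrite KE [i * _]mulrC [i * c]mulrC => /eqP.
have K0 : 0 \in K by rewrite inE mulr0.
have [e eE] := sum_nat K K0 KB nuK
  (fun x xK => etrans (congr1 _ (Kmul x xK)) (cZ x)).
set I1 := [set i | i * m%:R == (i + s) * c].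
set I2 := [set i | i * m%:R == (i - s) * c].
have I1E i : (i \in I1) = (M%:R * (q%:R - S) * i == s * c).
  rewrite inE -subr_eq0 -[RHS]subr_eq0 /m /c natrM; congr (_ == 0); ring.
have I2E i : (i \in I2) = (M%:R * (q%:R - S) * i == - (s * c)).
  rewrite inE -subr_eq0 -[RHS]subr_eq0 /m /c natrM; congr (_ == 0); ring.
have I1K : s * c = 0 -> I1 = K.
  by move=> sc; apply/setP => i; rewrite I1E sc inE.
have I2K : s * c = 0 -> I2 = K.
  by move=> sc; apply/setP => i; rewrite I2E sc oppr0 inE.
have I12 i : (i \in I2) = (- i \in I1).
  by rewrite I1E I2E mulrN eqr_oppLR.
have cap i : q <> 2%N \/ ~~ (8 %| k)%N -> i \in I1 -> s * c = 0.
  move=> q8; rewrite I1E => /eqP iE.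
  have e1 : M%:R * i * (q%:R - S) = M%:R * (q%:R - S) * i by ring.
  rewrite -iE -e1; apply: (geo_ideal_cap k_gt1 q_prime nuq q8 (be := s * M%:R)).
  by rewrite e1 iE /c; ring.
have trace_sum0 al : trace_sum u al m set0 qmul = 0.
  by rewrite /trace_sum big1 // => j _; rewrite big_set0.
rewrite card_cent_outer // -/z0.
have [q2|q2] := eqVneq q 2.
  (* If s c is also a multiple of q - S, then S kills it; being a multiple of S, it satisfies q s c
     = S s c, so 2 s c = 0. *)
  have Npp i : i \in I1 -> - (s * c) = s * c.
    rewrite I1E => /eqP iE; apply/eqP; rewrite eq_sym -addr_eq0 -mulr2n -mulr_natl.
    have -> : 2%:R = q%:R :> R by rewrite q2.
    have -> : q%:R * (s * c) = S * (s * c).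
      transitivity (s * M%:R * (q%:R * S)); first by rewrite /c; ring.
      by rewrite -(geo_mul_self nuq) /c; ring.
    rewrite -iE; apply/eqP.
    transitivity (M%:R * i * (q%:R * S - S * S)); first by ring.
    by rewrite (geo_mul_self nuq) subrr mulr0.
  have I21 : I2 = I1.
    apply/setP => i; apply/idP/idP => [|iI].
      by rewrite I12 => iI; rewrite -(opprK i) -I12 I2E (Npp _ iI) -I1E.
    by rewrite I2E (Npp _ iI) -I1E.
  have q20 : q%:R - 2%:R = 0 :> F by rewrite q2 subrr.
  rewrite I21 q20 mul0r if_same addr0.
  have z0N0 : (0 < z0 * N)%N by rewrite muln_gt0 z0_gt0 (ltnW N_gt1).
  have [sc|sc] := eqVneq (s * c) 0.
    apply: (int_nneg_div z0N0 _ (int_nneg_nat (wK * e)%N)).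
    by rewrite I1K // eE cardK !natrM q2; ring.
  have [I10|[i0 i0I]] := set_0Vmem I1.
    by rewrite I10 trace_sum0 addr0 mul0r; exact: (int_nneg_nat 0).
  have scN := Npp i0 i0I.
  (* When s c is nonzero, [K :|: I1] is a subgroup containing [K] with index 2, so the sum over [I1]
     is a difference of two subgroup sums. *)
  pose f i := M%:R * (q%:R - S) * i.
  have PE i : (i \in K :|: I1) = (f i == 0) || (f i == s * c).
    by rewrite in_setU I1E inE.
  have [e' e'E] : exists e : nat,
      trace_sum u m%:R m (K :|: I1) qmul = (#|K :|: I1| * l)%:R * e%:R.
    apply: sum_nat => [|x y|x|x].
    - by rewrite in_setU K0.
    - rewrite !PE /f [_ * (x - y)]mulrBr -/(f x) -/(f y).
      case/orP=> /eqP-> /orP[]/eqP->;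
        by rewrite ?subr0 ?sub0r ?subrr ?scN eqxx ?orbT.
    - rewrite !in_setU nuK !I1E mulrCA; congr (_ || _).
      have {1}-> : s * c = nu ^+ 1 * (s * c).
        transitivity (s * (M%:R * (nu ^+ 1 * S))); first by rewrite (nuX_geo nuq).
        by rewrite /c; ring.
      exact: nuX_eq 1 _ _.
    - rewrite in_setU => /orP[/Kmul->|]; first exact: cZ.
      by rewrite inE [x * _]mulrC [_ * c]mulrC => /eqP->; exact: cZ.
  have KI1 : [disjoint K & I1].
    rewrite -setI_eq0; apply/eqP/setP => i; rewrite in_setI I1E !inE.
    by apply/negP => /andP[/eqP->]; rewrite eq_sym (negPf sc).
  have cardI1 : #|I1| = #|K|.
    rewrite -[RHS](card_imset _ (addrI i0)); apply: eq_card => i.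
    apply/idP/imsetP => [iI|[x xK ->]].
      exists (i - i0); last by rewrite addrC subrK.
      move: iI i0I; rewrite !I1E inE [X in _ -> _ -> X == 0]mulrBr.
      by move=> /eqP-> /eqP->; rewrite subrr.
    move: xK i0I; rewrite !I1E inE [_ * (i0 + x)]mulrDr.
    by move=> /eqP-> /eqP->; rewrite addr0.
  have cardP : #|K :|: I1| = (2 * #|K|)%N.
    by rewrite cardsU disjoint_setI0 // cards0 subn0 cardI1 mul2n addnn.
  have sumP : trace_sum u m%:R m (K :|: I1) qmul =
      trace_sum u m%:R m K qmul + trace_sum u m%:R m I1 qmul.
    rewrite /trace_sum -big_split; apply: eq_bigr => j _.
    by rewrite -bigU //=; apply: eq_bigl => i; rewrite in_setU.
  have -> : trace_sum u m%:R m I1 qmul = (#|K| * l)%:R * (2%:R * e'%:R - e%:R).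
    apply: (addrI (trace_sum u m%:R m K qmul)).
    by rewrite -sumP e'E eE cardP !natrM; ring.
  apply: (int_nneg_div z0N0 (y := wK%:R * (2%:R * e'%:R - e%:R))).
    by rewrite cardK !natrM [in RHS]q2; ring.
  (* Nonnegativity is vacuous here: its hypotheses and [cap] would force s c = 0. *)
  split=> [|_ q8]; last by case/eqP: sc; exact: cap q8 i0I.
  apply: is_intM; first exact: is_int_nat.
  by rewrite -natrM; apply: is_intB; exact: is_int_nat.
have q_odd : odd q by case: (even_prime q_prime) q2 => [->|//]; rewrite eqxx.
have q8 : q <> 2%N \/ ~~ (8 %| k)%N by left; exact/eqP.
have [sc|sc] := eqVneq (s * c) 0; last first.
  have -> : I1 = set0.
    by apply/setP => i; rewrite [RHS]inE; apply: contraNF sc => /(cap _ q8) ->.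
  have -> : I2 = set0.
    apply/setP => i; rewrite [RHS]inE I12.
    by apply: contraNF sc => /(cap _ q8) ->.
  by rewrite trace_sum0 !addr0 mul0r; exact: (int_nneg_nat 0).
have [e2 e2E] := trace_sum_qmul_nat (al := c)
  (fun i => uz _ (cZ i)) (fun j _ => uj j).
have k_neq0 : k%:R != 0 :> F by rewrite pnatr_eq0 -lt0n (ltnW k_gt1).
(* By [geo_divisible], m K and c Z_k are the same subgroup, so the averages over [K] and over Z_k
   agree. *)
have TK : trace_sum u m%:R m K qmul = (#|K| * l)%:R * e2%:R.
  have [r [qr rS]] := geo_divisible k_gt1 q_prime nuq q_odd.
  have TT : trace_sum u m%:R m K qmul *+ k = trace_sum u c m [set: R] qmul *+ #|K|.
    rewrite -[X in _ *+ X = _]cardT; apply: trace_sum_same_image => //.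
    - by move=> x y _ _; rewrite in_setT.
    - by move=> x /Kmul xK; exists x; rewrite ?in_setT.
    move=> y _; exists (r * y).
      rewrite inE; apply/eqP.
      transitivity (r * (q%:R - S) * (M%:R * y)); first by ring.
      by rewrite rS mul0r.
    transitivity (M%:R * (q%:R * r) * y); first by rewrite qr.
    by rewrite /m natrM; ring.
  apply: (mulfI k_neq0); rewrite [LHS]mulr_natl TT e2E -[LHS]mulr_natl !natrM.
  by ring.
(* If nu fixes (nu - 1) x, then (nu - 1)^2 x = 0, and (nu - 1) S x = 0 yields q (nu - 1) x = 0;
   expanding S to second order in nu - 1 then puts x in [K]. *)
have [v vE] : exists v, #|~: K| = (z0 * (v * q))%N.
  have : (q %| #|[set ((nu - 1) * x)%R | x in ~: K]|)%N.
    apply: (free_mul_card q_prime nuq) => [_ /imsetP[x xK ->]|_ /imsetP[x xK ->]].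
      by apply/imsetP; exists (nu * x); [rewrite inE nuK -in_setC|ring].
    rewrite -subr_eq0; apply: contraTneq xK => fix_x; rewrite in_setC negbK.
    have zzx : (nu - 1) * ((nu - 1) * x) = 0 by rewrite -[RHS]fix_x; ring.
    have [w] := geo_taylor (nu - 1) q; rewrite addrC subrK => SE.
    have [h hE] : exists h : R, 'C(q, 2)%:R = q%:R * h.
      by exists q.-1./2%:R; rewrite bin2odd // natrM.
    have qzx : q%:R * ((nu - 1) * x) = 0.
      transitivity ((nu - 1) * S * x -
          ('C(q, 2)%:R + (nu - 1) * w) * ((nu - 1) * ((nu - 1) * x))).
        by rewrite SE; ring.
      by rewrite zzx mulrBl mul1r (nu_geo nuq) subrr mul0r mulr0 subrr.
    rewrite inE; apply/eqP; transitivity (- (M%:R * (h * (q%:R * ((nu - 1) * x))) +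
      M%:R * (w * ((nu - 1) * ((nu - 1) * x))))); first by rewrite SE hE; ring.
    by rewrite qzx zzx !mulr0 addr0 oppr0.
  case/dvdnP=> v vE; exists v; rewrite -vE; apply: card_mul_fibers => x y /KZ xyK.
  by rewrite !in_setC xyK.
rewrite I1K // I2K // /= TK e2E.
(* The integer comes from 2 |K| + (q - 2) k = q |K| + (q - 2) |~: K|, where |K| = z0 wK and |~: K| =
   z0 v q. *)
apply: (int_nneg_div _ _ (int_nneg_nat (e2 * (wK + (q - 2) * v))%N)).
  by rewrite muln_gt0 z0_gt0 (ltnW N_gt1).
have kF : k%:R = (z0 * wK + z0 * (v * q))%:R :> F.
  by rewrite -vE; exact: (congr1 _ kE).
rewrite cardK !natrM kF !natrD !natrM natrB ?prime_gt1 //.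
by ring.
Qed.

Lemma int_nneg_indicator_part m u : int_nneg (indicator_part pi m u / #|'C[u]%g|%:R).
Proof.
have [s [t uE]] := eltP u^-1%g; rewrite -[u]invgK uE.
have [/dvdnP[M ->]|qm] := boolP (q %| m)%N; last exact: int_nneg_coprime.
have [qt|] := boolP (q %| t)%N; last exact: int_nneg_outer.
by rewrite mulnC; exact: int_nneg_inner.
Qed.

End Traces.

End SemidirectProduct.

Theorem theorem4p11 (R : realType) (k q l n : nat)
    (k_gt0 : (0 < k)%N) (l_gt0 : (0 < l)%N) (n_gt0 : (0 < n)%N)
    (q_prime : prime q) (q_dvd : (q %| #|Aut (Zp k)|)%N)
    (nq_eq1 : (n ^ q)%N = 1%N %[mod k]) (n_neq1 : n <> 1%N %[mod k])
    (G : finGroupType)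
    (isoG : ([set: G] \isog
       Grp (a : b : a ^+ k, b ^+ (q * l), b * a * b^-1 = a ^+ n))%g)
    (V : vectType R[i])
    (rho : {linear drinfeld_double R[i] G -> 'End(V)})
    (V_module : is_left_module rho) :
  (forall m : nat, (0 < m)%N ->
     exists z : int, dd_indicator rho m = z%:~R) /\
  (~~ (q %| l)%N -> q <> 2%N \/ ~~ (8 %| k)%N ->
   forall m : nat, (0 < m)%N ->
     exists z : nat, dd_indicator rho m = z%:R).
Proof.
have k_gt1 : (1 < k)%N.
  rewrite ltn_neqAle k_gt0 andbT; apply/eqP => k1; apply: n_neq1.
  by rewrite -k1 !modn1.
have nuq : (n%:R : 'Z_k) ^+ q = 1.
  by rewrite -natrX -[RHS]/(1%:R); apply: ord_inj; rewrite !val_Zp_nat.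
have qlN : (1 < q * l)%N by rewrite (leq_trans (prime_gt1 q_prime)) // leq_pmulr.
have nuN : (n%:R : 'Z_k) ^+ (q * l) = 1 by rewrite exprM nuq expr1n.
have [a [b [ak bN ab bij_ab]]] := presentation_normal_form k_gt1 qlN nuN isoG.
have rep := module_mx_double_rep V_module.
have nu_m m : int_nneg k q l (dd_indicator rho m).
  rewrite dd_indicatorE (mean_indicator_part rep).
  have part_spec u := int_nneg_indicator_part k_gt1 l_gt0 q_prime nuq ak bN ab
    bij_ab rep m u.
  split=> [|ql q8].
    by apply: is_int_sum => uG _; case: (part_spec (repr uG)).
  by apply: sumr_ge0 => uG _; case: (part_spec (repr uG)) => _; exact.
split=> [m _|ql q8 m _]; first by case: (nu_m m).
by case: (nu_m m) => m_int /(_ ql q8); exact: is_int_ge0.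
Qed.
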